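(* Let $T$ be a tournament of order at least $5$ that is not a transitive tournament of even order. Then there exists a subset $X\subseteq \bigcup \mathrm{mc}(T)$ with $|X|=\Delta(T)$ such that $\mathrm{Inv}(T,X)$ is indecomposable. Moreover, $\delta'(T)=\Delta(T)$.
   Context: A tournament $T=(V(T),A(T))$ is a finite vertex set with, for every two distinct vertices $x,y$, exactly one of the arcs $(x,y),(y,x)$ in $A(T)$; its order is $|V(T)|$. $T$ is transitive if $(x,y),(y,z)\in A(T)$ implies $(x,z)\in A(T)$. For $X\subseteq V(T)$, $\overline X=V(T)\setminus X$, and $\mathrm{Inv}(T,X)$ is the tournament obtained from $T$ by reversing all arcs having both endpoints in $X$. A module of $T$ is a set $M\subseteq V(T)$ such that for all $x,y\in M$ and $v\in V(T)\setminus M$, $(v,x)\in A(T)$ if and only if $(v,y)\in A(T)$. The trivial modules are $\varnothing$, the singletons $\{u\}$ ($u\in V(T)$) and $V(T)$. $T$ is indecomposable if all its modules are trivial, and decomposable otherwise. A co-module of $T$ is a set $M\subseteq V(T)$ such that $M$ or $\overline M$ is a nontrivial module of $T$. $\mathrm{mc}(T)$ denotes the set of co-modules of $T$ that are minimal under inclusion among all co-modules of $T$, and $\bigcup\mathrm{mc}(T)$ is the union of its elements. The co-modular index $\Delta(T)$ is the maximum size of a set of pairwise disjoint co-modules of $T$ (so $\Delta(T)=0$ if $T$ is indecomposable). For $T$ of order at least $5$ that is not transitive of even order, the decomposability subtournament-index $\delta'(T)$ is the smallest integer $m$ for which there exists $X\subseteq V(T)$ with $|X|=m$ such that $\mathrm{Inv}(T,X)$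 is indecomposable (existence of such an $X$ is part of the first assertion). *)

(* Defs.v *)
From mathcomp Require Import all_boot.

Set Implicit Arguments.
Unset Strict Implicit.
Unset Printing Implicit Defensive.

Section Tournaments.

Variables (V : finType) (T : rel V).
Implicit Types (X M : {set V}) (P : {set {set V}}).

(* [T x y] means that (x, y) is an arc. *)
Definition tournament : Prop :=
  irreflexive T /\ forall x y, x != y -> T x y (+) T y x.

Definition Inv X : rel V :=
  fun x y => if (x \in X) && (y \in X) then T y x else T x y.

Definition is_module M : bool :=
  [forall x in M, forall y in M, forall v in ~: M, T v x == T v y].

Definition trivial_vset M : bool :=
  [|| M == set0, [exists u, M == [set u]] | M == [set: V]].

Definition nontrivial_module M : bool := is_module M && ~~ trivial_vset M.

Definition indecomposable : bool :=
  [forall M, is_module M ==> trivial_vset M].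

Definition comodule M : bool :=
  nontrivial_module M || nontrivial_module (~: M).

Definition mc : {set {set V}} := [set M | minset comodule M].

Definition comodular_index : nat :=
  \max_(P : {set {set V}} | [forall M in P, comodule M] && trivIset P) #|P|.

End Tournaments.

(* Relational, so that the existence of a suitable X is part of the claim. *)
Definition is_subtournament_index (V : finType) (T : rel V) (m : nat) : Prop :=
  (exists X : {set V}, #|X| = m /\ indecomposable (Inv T X)) /\
  (forall X : {set V}, indecomposable (Inv T X) -> m <= #|X|).

(* Main.v *)
(* Every X with Inv(T,X) indecomposable meets every co-module, whence
   Delta(T) <= |X|. Conversely, minimal co-modules are pairwise disjoint, except
   for pairs of twins (2-element modules), which form directed paths. Take every
   second vertex of each path of twins, with the parity forced at a source or a
   sink of T (no conflict arises unless T is transitive of even order), and one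
   vertex without a twin in every other non-singleton minimal co-module. The
   resulting X meets every co-module, contains no nontrivial module, and its
   points lie in pairwise disjoint minimal co-modules G x, so |X| = Delta(T).

   If M is a nontrivial module of Inv(T,X), the sets M & X, M \ X and X \ M are
   nonempty, and comparing how the blocks G x sit with respect to M shows that
   both M & X and X \ M are singletons. Hence Inv(T,X) is indecomposable if
   |X| <> 2, and if |X| = 2 the possible failures are explicit enough to be
   repaired by moving one of the two points of X inside its block. *)
Require Import Defs.
From mathcomp Require Import all_boot.

Set Implicit Arguments.
Unset Strict Implicit.
Unset Printing Implicit Defensive.

(** * Chains in a relation with unique predecessors *)

Section Ancestors.

Variables (V : finType) (e : rel V).

Definition ancestors v := [set w | connect e w v].

Hypothesis pred_uniq : forall u x y, e u y -> e x y -> u = x.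
Hypothesis acyclic : forall x y, e x y -> ~~ connect e y x.

Lemma ancestors_step x y : e x y -> ancestors y = y |: ancestors x.
Proof.
move=> exy; apply/setP=> w; rewrite !inE; apply/idP/orP.
  case/connectP=> p; case/lastP: p => [|p z] /=; first by move=> _ ->; left.
  rewrite last_rcons rcons_path => /andP[ep ez] yz; right.
  by apply/connectP; exists p => //; apply: pred_uniq exy _; rewrite yz.
case=> [/eqP->|cwx]; first exact: connect0.
exact: connect_trans cwx (connect1 exy).
Qed.

Lemma card_ancestors_step x y : e x y -> #|ancestors y| = #|ancestors x|.+1.
Proof.
by move=> exy; rewrite (ancestors_step exy) cardsU1 inE (acyclic exy).
Qed.

Lemma ancestors_root x : (forall w, ~~ e w x) -> ancestors x = [set x].
Proof.
move=> rx; apply/setP=> w; rewrite !inE; apply/idP/eqP=> [|->]; last exact: connect0.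
case/connectP=> p; case/lastP: p => [|p z] //=.
rewrite last_rcons rcons_path => /andP[_ ez] xz.
by case/negP: (rx (last w p)); rewrite xz.
Qed.

End Ancestors.

(** * Modules and minimal co-modules *)

Section Modules.

Variables (V : finType) (T : rel V).
Implicit Type M : {set V}.

Lemma moduleP M :
  reflect (forall x y v, x \in M -> y \in M -> v \notin M -> T v x = T v y)
          (is_module T M).
Proof.
apply: (iffP forallP) => [h x y v xM yM vM | h x].
  move: (h x) => /implyP/(_ xM)/forallP/(_ y)/implyP/(_ yM)/forallP/(_ v)/implyP.
  by rewrite inE => /(_ vM)/eqP.
apply/implyP=> xM; apply/forallP=> y; apply/implyP=> yM.
by apply/forallP=> v; apply/implyP; rewrite inE => vM; apply/eqP/h.
Qed.

Lemma trivialE M :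
  trivial_vset M = ~~ ((1 < #|M|) && (#|M| < #|V|)).
Proof.
rewrite /trivial_vset.
have -> : [exists u, M == [set u]] = (#|M| == 1).
  by apply/existsP/cards1P=> -[u]; [move/eqP | move=> ->]; exists u.
have -> : (M == [set: V]) = (#|V| <= #|M|).
  by rewrite eqEcard subsetT cardsT.
rewrite -cards_eq0 negb_and -!leqNgt; case: #|M| => [|[|m]] //=.
Qed.

Lemma nontrivE M :
  nontrivial_module T M = [&& is_module T M, 1 < #|M| & #|M| < #|V|].
Proof. by rewrite /nontrivial_module trivialE negbK. Qed.

End Modules.

(** Being a module depends only on the arcs between M and its complement, and in both cases no such
    arc has its two ends in X. *)
Lemma Inv_module (V : finType) (T : rel V) (M X : {set V}) :
  [disjoint X & M] || (X \subset M) ->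
  is_module (Inv T X) M = is_module T M.
Proof.
move=> XM; have h v x : x \in M -> v \notin M -> Inv T X v x = T v x.
  move=> xM vM; rewrite /Inv; case: ifP => // /andP[vX xX].
  case/orP: XM => [/pred0P/(_ x)/=|/subsetP/(_ v vX)]; first by rewrite xX xM.
  by rewrite (negbTE vM).
apply/moduleP/moduleP=> mM x y v xM yM vM; first by rewrite -!h // (mM x y).
by rewrite !h // (mM x y).
Qed.

Section Tournament.

Variables (V : finType) (T : rel V).
Hypothesis tourT : tournament T.
Hypothesis order_ge5 : 5 <= #|V|.
Implicit Types (x y v w : V) (M N D X : {set V}).

Local Notation module := (is_module T).
Local Notation nontriv := (nontrivial_module T).
Local Notation comod := (comodule T).
Local Notation MC := (mc T).

Lemma arcN x y : x != y -> T x y = ~~ T y x.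
Proof. by case: tourT => _ /[apply]; case: (T x y); case: (T y x). Qed.

Lemma arc_irr x : T x x = false. Proof. by case: tourT. Qed.

Lemma module_arc M x y v :
  module M -> x \in M -> y \in M -> v \notin M -> T x v = T y v.
Proof.
move=> /moduleP h xM yM vM; rewrite !(arcN (y := v)) ?(h x y v) //.
  by apply: contraNneq vM => <-.
by apply: contraNneq vM => <-.
Qed.

Lemma card_lt M z : z \notin M -> #|M| < #|V|.
Proof.
by move=> zM; rewrite ltnNge -cardsT; apply: contra zM => h;
  rewrite (eqP (_ : M == setT)) ?inE // eqEcard subsetT.
Qed.

Lemma nontrivI M x y z :
  module M -> x \in M -> y \in M -> x != y -> z \notin M -> nontriv M.
Proof.
move=> mM xM yM nxy zM; rewrite nontrivE mM (card_lt zM) andbT /=.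
by apply/card_gt1P; exists x, y.
Qed.

Lemma nontriv_module M : nontriv M -> module M.
Proof. by case/andP. Qed.

Lemma card_gt1_other M x : 1 < #|M| -> exists2 y, y \in M & y != x.
Proof.
case/card_gt1P=> y [z] [yM zM nyz]; have [eyx|] := eqVneq y x; last by exists y.
by exists z => //; rewrite eq_sym -eyx.
Qed.

Lemma nontriv_other M x : nontriv M -> exists2 y, y \in M & y != x.
Proof. by rewrite nontrivE => /and3P[_ + _]; apply: card_gt1_other. Qed.

Lemma comodC M : comod (~: M) = comod M.
Proof. by rewrite /comodule setCK orbC. Qed.

Lemma nontriv_comod M : nontriv M -> comod M.
Proof. by rewrite /comodule => ->. Qed.

Lemma nontrivC_comod M : nontriv (~: M) -> comod M.
Proof. by rewrite /comodule => ->; rewrite orbT. Qed.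

Lemma comod_neq0 M : comod M -> exists x, x \in M.
Proof.
move=> cM; apply/set0Pn; apply: contraL cM => /eqP->.
by rewrite /comodule !nontrivE setC0 cards0 cardsT ltnn !andbF.
Qed.

Lemma mc_comod M : M \in MC -> comod M.
Proof. by rewrite inE => /minsetp. Qed.

Lemma mc_min M D : M \in MC -> comod D -> D \subset M -> D = M.
Proof. by rewrite inE => h cD; apply: (minsetinf h). Qed.

Lemma comod_mc D : comod D -> exists2 M, M \in MC & M \subset D.
Proof.
by case/minset_exists=> M hM sM; exists M => //; rewrite inE.
Qed.

Lemma moduleI M N : module M -> module N -> module (M :&: N).
Proof.
move=> /moduleP mM /moduleP mN; apply/moduleP=> x y v.
rewrite !inE => /andP[xM xN] /andP[yM yN]; rewrite negb_and.
by case/orP=> [/(mM x y v)->|/(mN x y v)->].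
Qed.

Lemma moduleU M N w :
  module M -> module N -> w \in M -> w \in N -> module (M :|: N).
Proof.
move=> /moduleP mM /moduleP mN wM wN; apply/moduleP=> x y v.
rewrite !inE => xMN yMN; rewrite negb_or => /andP[vM vN].
have h z : (z \in M) || (z \in N) -> T v z = T v w.
  by case/orP=> [zM|zN]; [apply: mM | apply: mN].
by rewrite (h x) // (h y).
Qed.

(** The delicate v lies in M and N: towards M \ N it behaves like z, because N is a module, and z is
    outside the module M. *)
Lemma moduleD M N z :
  module M -> module N -> z \in N -> z \notin M -> module (M :\: N).
Proof.
move=> mM mN zN zM; apply/moduleP=> x y v.
rewrite !inE => /andP[xN xM] /andP[yN yM]; rewrite negb_and negbK.
have [vN _|vN /= vM] := boolP (v \in N); last exact: (moduleP _ _ mM).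
rewrite (module_arc mN vN zN xN) (module_arc mN vN zN yN).
exact: (moduleP _ _ mM).
Qed.

Lemma mc_not_sub M N : M \in MC -> N \in MC -> M != N ->
  exists2 z, z \in M & z \notin N.
Proof.
move=> hM hN nMN; apply/subsetPn; apply: contra nMN => sMN.
by apply/eqP/(mc_min hN) => //; apply: mc_comod.
Qed.

(** Each overlap other than that of two modules yields a smaller co-module. If M and the complement
    of N are modules, so is their union, and N \ M is a co-module; likewise with M and N exchanged.
    If both complements are modules, either they are disjoint and the complement of M is a co-module
    inside N, or their union is a module and M & N is a co-module. If M and N are modules, M & N and
    M \ N are modules properly inside M, hence singletons. *)
Lemma mc_meet M N w : M \in MC -> N \in MC -> M != N ->
  w \in M -> w \in N -> (#|M| == 2) && module M.
Proof.
move=> hM hN nMN wM wN.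
have [m mM mN] := mc_not_sub hM hN nMN.
have [n nN nM] := mc_not_sub hN hM (contra_neq (@esym _ _ _) nMN).
have mixed M' N' m' n' : M' \in MC -> N' \in MC -> nontriv M' -> nontriv (~: N') ->
    m' \in M' -> m' \notin N' -> n' \in N' -> n' \notin M' -> w \in M' -> w \in N' -> False.
  move=> hM' hN' tM' tN' mM' mN' nN' nM' wM' wN'.
  have : N' :\: M' = N'.
    apply: (mc_min hN'); last exact: subsetDl.
    apply: nontrivC_comod; rewrite setCD.
    apply: (@nontrivI _ m' w n'); rewrite ?inE ?mM' ?wM' ?nN' ?orbT //=.
      by apply: (@moduleU _ _ m'); rewrite ?inE // nontriv_module.
    by apply: contraNneq mN' => ->.
  by move/setP/(_ w); rewrite !inE wM' wN'.
case/orP: (mc_comod hM) (mc_comod hN) => tM /orP[] tN.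
- have [mdM mdN] := (nontriv_module tM, nontriv_module tN).
  have small D x : module D -> D \subset M -> x \in M -> x \notin D -> #|D| <= 1.
    move=> mD sD xM xD; rewrite leqNgt; apply: contra xD => gt1.
    rewrite (mc_min hM _ sD) //; apply: nontriv_comod.
    rewrite nontrivE mD gt1 /=; apply: leq_ltn_trans (card_lt nM).
    exact: subset_leq_card.
  rewrite mdM andbT -(cardsID N M).
  have := small _ m (moduleI mdM mdN) (subsetIl _ _) mM; rewrite !inE (negbTE mN) andbF => /(_ isT).
  have := small _ w (moduleD mdM mdN nN nM) (subsetDl _ _) wM; rewrite !inE wN => /(_ isT).
  have : 0 < #|M :&: N| by apply/card_gt0P; exists w; rewrite !inE wM.
  have : 0 < #|M :\: N| by apply/card_gt0P; exists m; rewrite !inE mM mN.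
  by case: #|_ :&: _| => [|[|]] //; case: #|_ :\: _| => [|[|]].
- by case: (mixed M N m n).
- by case: (mixed N M n m).
- have [eqU|[z]] := set_0Vmem (~: M :&: ~: N).
    have : ~: M = N.
      apply: (mc_min hN); first exact: nontriv_comod.
      apply/subsetP=> x; rewrite inE => xM; have := in_set0 x.
      by rewrite -eqU !inE xM /= => /negbFE.
    by move/setP/(_ w); rewrite !inE wM wN.
  rewrite inE => /andP[zM zN].
  have : M :&: N = M.
    apply: (mc_min hM); last exact: subsetIl.
    apply: nontrivC_comod; rewrite setCI.
    apply: (@nontrivI _ m n w); rewrite ?inE ?mM ?nN ?nM ?mN ?wM ?wN //.
      exact: (moduleU (nontriv_module tM) (nontriv_module tN) zM zN).
    by apply: contraNneq nM => <-.
  by move/setP/(_ m); rewrite !inE mM (negbTE mN).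
Qed.

Lemma isolated_arc x :
  comod [set x] -> exists eps, forall v, v != x -> T x v = eps.
Proof.
case/orP=> tx; first by move: tx; rewrite nontrivE cards1 andbF.
have [y yC nyx] := nontriv_other x tx; exists (T x y) => v nvx.
by apply: (moduleP _ _ (nontriv_module tx)); rewrite ?inE ?negbK.
Qed.

Lemma isolatedI x eps : (forall v, v != x -> T x v = eps) -> comod [set x].
Proof.
move=> h; apply: nontrivC_comod; rewrite nontrivE cardsC1.
apply/and3P; split; last 2 first.
- by case: #|V| order_ge5 => [|[|[|n]]].
- by case: #|V| order_ge5 => [|n].
apply/moduleP=> y z v; rewrite !inE negbK => ny nz /eqP->.
by rewrite !h.
Qed.

Lemma isolated_mc x : comod [set x] -> [set x] \in MC.
Proof.
move=> cx; have [M hM sM] := comod_mc cx; suff <- : M = [set x] by [].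
by move: sM; rewrite subset1 => /orP[/eqP//|/eqP M0];
  have [y] := comod_neq0 (mc_comod hM); rewrite M0 inE.
Qed.

Lemma mc_isolated M x : M \in MC -> x \in M -> comod [set x] -> M = [set x].
Proof. by move=> hM xM cx; rewrite (mc_min hM cx) // sub1set. Qed.

Lemma pairP x y :
  reflect (forall v, v != x -> v != y -> T v x = T v y) (module [set x; y]).
Proof.
apply: (iffP (moduleP _ _)) => [h v nx ny | h a b v].
  by apply: h; rewrite !inE ?eqxx ?orbT // negb_or nx.
rewrite !inE negb_or => /orP[]/eqP-> /orP[]/eqP-> /andP[nx ny] //.
  exact: h.
by rewrite h.
Qed.

Lemma pair_arc x y v :
  module [set x; y] -> v != x -> v != y -> T x v = T y v.
Proof.
by move=> m nx ny; apply: (module_arc m); rewrite !inE ?eqxx ?orbT // negb_or nx.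
Qed.

Lemma pair_nontriv x y : x != y -> module [set x; y] -> nontriv [set x; y].
Proof.
move=> nxy m; rewrite nontrivE m cards2 nxy /=.
exact: leq_trans _ order_ge5.
Qed.

(** * Paths of twins *)

Definition twin x y := T x y && module [set x; y].

Lemma twin_neq x y : twin x y -> x != y.
Proof. by case/andP=> + _; apply: contraTneq => ->; rewrite arc_irr. Qed.

Lemma arc_asym x y : T x y -> ~~ T y x.
Proof.
move=> Txy; rewrite -arcN //; apply: contraTneq Txy => ->.
by rewrite arc_irr.
Qed.

Lemma module_twin x y :
  x != y -> module [set x; y] -> twin x y \/ twin y x.
Proof.
move=> nxy m; rewrite /twin (setUC [set y]) m !andbT (arcN nxy).
by case: (T y x); [right | left].
Qed.

(** If u and x differ, x does not separate u from y, so x beats u; and u does not separate x from y,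
    so y beats u, against the arc from u to y. *)
Lemma twin_pred_uniq u x y : twin u y -> twin x y -> u = x.
Proof.
move=> /[dup] /twin_neq nuy /andP[uy muy] /[dup] /twin_neq nxy /andP[xy mxy].
apply/eqP/negPn/negP=> nux.
have := arc_asym uy; rewrite -(pair_arc mxy nux nuy).
have -> : T x u = T x y by apply: (pairP _ _ muy); rewrite // eq_sym.
by rewrite xy.
Qed.

Lemma twin_succ_uniq u x y : twin y u -> twin y x -> u = x.
Proof.
move=> /[dup] /twin_neq nyu /andP[yu myu] /[dup] /twin_neq nyx /andP[yx myx].
apply/eqP/negPn/negP=> nux.
have nuy : u != y by rewrite eq_sym.
have nxy : x != y by rewrite eq_sym.
have nxu : x != u by rewrite eq_sym.
by have := arc_asym yu; rewrite (pairP _ _ myx) // -(pair_arc myu) // yx.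
Qed.

(** The negated conjunction says that v is off the path from x to y; such a v cannot separate two
    consecutive vertices. *)
Lemma twin_path_arc v x y : connect twin x y ->
  ~~ (connect twin x v && connect twin v y) -> T v x = T v y.
Proof.
case/connectP=> p + ->; elim: p x => //= z p IHp x /andP[xz pz] nv.
have zy : connect twin z (last z p) by apply/connectP; exists p.
have nvx : v != x.
  apply: contraNneq nv => ->; rewrite connect0.
  exact: connect_trans (connect1 xz) zy.
have nvz : v != z.
  by apply: contraNneq nv => ->; rewrite zy connect1.
rewrite -(IHp z pz); first by case/andP: xz => _ /pairP->.
by apply: contra nv => /andP[zv ->]; rewrite (connect_trans (connect1 xz)).
Qed.

Lemma connect_twin_arc x y : connect twin x y -> x != y -> T x y.
Proof.
case/connectP=> p; elim: p x => [|z p IHp] x /=; first by move=> _ ->; rewrite eqxx.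
move=> /andP[xz pz] ylast nxy; have [-> |nyz] := eqVneq y z; first by case/andP: xz.
have zy := IHp z pz ylast; case/andP: xz => Txz mxz.
have nyx : y != x by rewrite eq_sym.
by rewrite (pair_arc mxz) // zy // eq_sym.
Qed.

Lemma twin_acyclic x y : twin x y -> ~~ connect twin y x.
Proof.
move=> txy; apply/negP=> /connect_twin_arc; rewrite eq_sym twin_neq // => /(_ isT).
by case/andP: txy => /arc_asym/negP.
Qed.

Definition source a := [forall v, (v != a) ==> T a v].
Definition sink z := [forall v, (v != z) ==> T v z].

Lemma sourceP a : reflect (forall v, v != a -> T a v) (source a).
Proof. by apply: (iffP forallP) => h v; apply/implyP; apply: h. Qed.

Lemma sinkP z : reflect (forall v, v != z -> T v z) (sink z).
Proof. by apply: (iffP forallP) => h v; apply/implyP; apply: h. Qed.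

Lemma isolated_source_sink x : comod [set x] = source x || sink x.
Proof.
apply/idP/orP=> [/isolated_arc[[] h]|[/sourceP h|/sinkP h]].
- by left; apply/sourceP.
- by right; apply/sinkP=> v nvx; rewrite arcN // h.
- exact: (@isolatedI _ true).
- apply: (@isolatedI _ false) => v nvx; rewrite arcN 1?eq_sym // h //.
Qed.

(** A vertex off the path would see a and z alike, yet it loses to the source a and beats the sink
    z. So the path is all of V. *)
Lemma twin_source_sink_transitive a z :
  source a -> sink z -> connect twin a z ->
  ancestors twin z = setT /\ transitive T.
Proof.
move=> /sourceP sa /sinkP sz caz.
have all v : connect twin a v && connect twin v z.
  apply/negPn/negP=> nv.
  have := twin_path_arc caz nv.
  have nva : v != a by apply: contraNneq nv => ->; rewrite connect0.
  have nvz : v != z by apply: contraNneq nv => ->; rewrite connect0 caz.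
  by rewrite sz //; apply/negP/arc_asym/sa.
split; first by apply/setP=> v; rewrite !inE; case/andP: (all v).
(* If y did not come after x, then x would be off the path from a to y and would beat a as it beats
   y. *)
have arc_connect x y : T x y -> connect twin x y.
  move=> Txy; have /andP[cay _] := all y.
  apply/negPn/negP=> nc.
  have : ~~ (connect twin a x && connect twin x y) by rewrite (negbTE nc) andbF.
  move/(twin_path_arc cay); rewrite Txy => Txa.
  have [exa|/sa/arc_asym] := eqVneq x a; last by rewrite Txa.
  by rewrite exa arc_irr in Txa.
move=> y x w Txy Tyw; apply: connect_twin_arc.
  exact: connect_trans (arc_connect _ _ Txy) (arc_connect _ _ Tyw).
by apply: contraTneq Tyw => <-; apply: arc_asym.
Qed.

(** Taken as ancestors for the converse relation, so that the lemmas on chains apply through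
    [twin_succ_uniq]. *)
Definition descendants v := ancestors (fun x y => twin y x) v.

Lemma descendantsE v w : (w \in descendants v) = connect twin v w.
Proof. by rewrite inE; have := connect_rev twin w v => /= ->. Qed.

Lemma card_anc x y :
  twin x y -> #|ancestors twin y| = #|ancestors twin x|.+1.
Proof.
apply: (card_ancestors_step (e := twin)); last exact: twin_acyclic.
exact: twin_pred_uniq.
Qed.

Lemma anc_step x y : twin x y -> ancestors twin y = y |: ancestors twin x.
Proof. apply: ancestors_step; exact: twin_pred_uniq. Qed.

Lemma desc_step x y : twin x y -> descendants x = x |: descendants y.
Proof.
move=> txy; apply: (ancestors_step (e := fun x y => twin y x)) => //.
by move=> u v w; apply: twin_succ_uniq.
Qed.

Lemma card_desc x y : twin x y -> #|descendants x| = #|descendants y|.+1.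
Proof.
move=> txy; rewrite (desc_step txy) cardsU1 descendantsE.
by rewrite (twin_acyclic txy).
Qed.

Definition from_source v := [exists a in ancestors twin v, source a].
Definition to_sink v := [exists z in descendants v, sink z].

(* A path of twins starting at a source must contribute its first vertex, one
   ending at a sink its last vertex, and any other path as few vertices
   as possible, namely its second, fourth, ... ones. *)
Definition alternate : {set V} :=
  [set v | if from_source v then odd #|ancestors twin v|
           else if to_sink v then odd #|descendants v|
           else ~~ odd #|ancestors twin v|].

Lemma from_source_twin x y : twin x y -> from_source x = from_source y.
Proof.
move=> txy; rewrite /from_source (anc_step txy).
apply/existsP/existsP=> -[a /andP[aA sa]]; exists a; rewrite sa andbT.
  by rewrite in_setU1 aA orbT.
move: aA; rewrite in_setU1 => /orP[/eqP eay|//].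
case/andP: (txy) => /arc_asym/negP[]; rewrite -eay.
by apply: (sourceP _ sa); rewrite eay; apply: twin_neq.
Qed.

Lemma to_sink_twin x y : twin x y -> to_sink x = to_sink y.
Proof.
move=> txy; rewrite /to_sink (desc_step txy).
apply/existsP/existsP=> -[a /andP[aA sa]]; exists a; rewrite sa andbT.
  move: aA; rewrite in_setU1 => /orP[/eqP eax|//].
  case/andP: (txy) => /arc_asym/negP[]; rewrite -eax.
  by apply: (sinkP _ sa); rewrite eax eq_sym; apply: twin_neq.
by rewrite in_setU1 aA orbT.
Qed.

Lemma alternate_twin x y : twin x y -> (x \in alternate) = (y \notin alternate).
Proof.
move=> txy; rewrite !inE (from_source_twin txy) (to_sink_twin txy).
rewrite (card_anc txy) (card_desc txy) /=.
by case: ifP => _; [|case: ifP => _]; rewrite ?negbK.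
Qed.

Lemma alternate_pair x y : x != y -> module [set x; y] ->
  (x \in alternate) = (y \notin alternate).
Proof.
by move=> nxy /(module_twin nxy)[/alternate_twin//|/alternate_twin->]; rewrite negbK.
Qed.

Lemma anc_source a : source a -> ancestors twin a = [set a].
Proof.
move=> /sourceP sa; apply: ancestors_root => w; apply/negP=> t.
case/andP: (t) => Twa _; case/negP: (arc_asym Twa).
by apply: sa; apply: twin_neq t.
Qed.

Lemma desc_sink z : sink z -> descendants z = [set z].
Proof.
move=> /sinkP sz; apply: ancestors_root => w; apply/negP=> t.
case/andP: (t) => Tzw _; case/negP: (arc_asym Tzw).
by apply: sz; rewrite eq_sym; apply: twin_neq t.
Qed.

Hypothesis not_even_transitive : ~ (transitive T /\ ~~ odd #|V|).

(** A source or a sink is at position 1 counted from its own end. The only conflict is a sink on a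
    path that begins at a source: the path is then all of V and T is transitive, so the position of
    the sink is |V|, which is odd. *)
Lemma isolated_alternate x : comod [set x] -> x \in alternate.
Proof.
rewrite isolated_source_sink inE => /orP[sx|sx].
  have -> : from_source x.
    by apply/existsP; exists x; rewrite sx inE connect0.
  by rewrite anc_source // cards1.
case: ifPn => [/existsP[a /andP[]]|_].
  rewrite inE => cax sa; have [-> trT] := twin_source_sink_transitive sa sx cax.
  by rewrite cardsT; apply/negPn/negP => ev; apply: not_even_transitive.
have -> : to_sink x by apply/existsP; exists x; rewrite sx descendantsE connect0.
by rewrite desc_sink // cards1.
Qed.

(** A smaller co-module would be {w}; then w would be a source or a sink, hence in [alternate]
    together with its twin x. *)
Lemma alternate_pair_mc x w : x \in alternate -> ~~ comod [set x] ->
  x != w -> module [set x; w] -> [set x; w] \in MC.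
Proof.
move=> xA cx nxw m; have [M hM sM] := comod_mc (nontriv_comod (pair_nontriv nxw m)).
suff <- : M = [set x; w] by [].
apply/eqP; rewrite eqEsubset sM; apply/subsetP.
have [u uM] := comod_neq0 (mc_comod hM).
have other a b : a \in M -> b \notin M -> M \subset [set a; b] -> comod [set a].
  move=> aM bM /subsetP s; suff <- : M = [set a] by apply: mc_comod.
  apply/setP=> v; rewrite inE; apply/idP/eqP=> [vM|-> //].
  by move: (s _ vM); rewrite !inE => /orP[/eqP//|/eqP evb]; rewrite -evb vM in bM.
have xM : x \in M.
  apply/negPn/negP=> xM; have wM : w \in M.
    have := subsetP sM _ uM; rewrite !inE => /orP[]/eqP eu; last by rewrite -eu.
    by rewrite eu (negbTE xM) in uM.
  have := isolated_alternate (other w x wM xM _); rewrite setUC => /(_ sM).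
  by rewrite -[_ \in _]negbK -(alternate_pair nxw m) xA.
have wM : w \in M.
  by apply/negPn/negP=> wM; case/negP: cx; apply: other wM sM.
by move=> v; rewrite !inE => /orP[]/eqP->.
Qed.

(** True when [alternate] counts positions from the beginning of the path; the block of a vertex
    then extends towards that end. *)
Definition blocks_up x := from_source x || ~~ to_sink x.

(* The minimal co-module represented by a vertex x of [alternate]: {x} itself
   or x paired with its neighbour on the path of twins, chosen uniformly along
   the path so that blocks are disjoint. *)
Definition block x : {set V} :=
  if comod [set x] then [set x]
  else if blocks_up x then [set w | (w == x) || twin w x]
  else [set w | (w == x) || twin x w].

Lemma blocks_up_twin x y : twin x y -> blocks_up x = blocks_up y.
Proof.
by move=> t; rewrite /blocks_up (from_source_twin t) (to_sink_twin t).
Qed.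

(** Without a neighbour on the side where counting starts, x is at position 1. Not being a source or
    a sink, it then starts a count that selects even positions, or else contradicts the choice of
    side. *)
Lemma alternate_partner x : x \in alternate -> ~~ comod [set x] ->
  exists w, if blocks_up x then twin w x else twin x w.
Proof.
rewrite isolated_source_sink negb_or => xA /andP[nsrc nsnk].
apply/existsP; apply: contraTT xA; rewrite negb_exists => /forallP.
case: (boolP (blocks_up x)) => up h; rewrite inE.
  have ax : ancestors twin x = [set x] by apply: ancestors_root.
  have fs : from_source x = false.
    apply/negbTE/existsP=> -[a]; rewrite ax inE => /andP[/eqP->].
    by rewrite (negbTE nsrc).
  by move: up; rewrite /blocks_up fs /= => /negbTE->; rewrite ax cards1.
have dx : descendants x = [set x] by apply: ancestors_root.
move: up; rewrite negb_or negbK => /andP[_] /existsP[z].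
by rewrite dx inE => /andP[/eqP->]; rewrite (negbTE nsnk).
Qed.

Lemma block_cases x : x \in alternate ->
  (comod [set x] /\ block x = [set x]) \/
  (~~ comod [set x] /\ exists w,
     [/\ if blocks_up x then twin w x else twin x w,
         block x = [set x; w], x != w & module [set x; w]]).
Proof.
move=> xA; rewrite /block; case: ifPn => cx; [by left | right; split=> //].
have [w] := alternate_partner xA cx; case: ifP => up t; exists w; split=> //.
- apply/setP=> v; rewrite !inE; congr (_ || _).
  by apply/idP/eqP=> [tv|->//]; apply: twin_pred_uniq tv t.
- by rewrite eq_sym twin_neq.
- by rewrite setUC; case/andP: t.
- apply/setP=> v; rewrite !inE; congr (_ || _).
  by apply/idP/eqP=> [tv|->//]; apply: twin_succ_uniq tv t.
- exact: twin_neq.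
- by case/andP: t.
Qed.

Lemma mem_block x : x \in alternate -> x \in block x.
Proof. by case/block_cases=> [[_ ->]|[_ [w [_ -> _ _]]]]; rewrite !inE eqxx. Qed.

Lemma block_mc x : x \in alternate -> block x \in MC.
Proof.
move=> xA; case: (block_cases xA) => [[cx ->]|[cx [w [_ -> nxw m]]]].
  exact: isolated_mc.
exact: alternate_pair_mc.
Qed.

(** A common vertex forces both blocks to extend in the same direction. It is not x or y, since
    twins are not both in [alternate], and as a common partner it determines its neighbour on the
    path. *)
Lemma block_disjoint x y w :
  x \in alternate -> y \in alternate -> w \in block x -> w \in block y -> x = y.
Proof.
move=> xA yA.
have sub u v : u \in alternate -> v \in alternate -> comod [set u] ->
    u \in block v -> u = v.
  move=> uA vA cu uv; have := mem_block vA.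
  by rewrite (mc_isolated (block_mc vA) uv cu) inE => /eqP.
case: (block_cases xA) => [[cx ->]|[ncx [x' [tx ex _ _]]]].
  by rewrite inE => /eqP->; apply: sub.
case: (block_cases yA) => [[cy ->]|[ncy [y' [ty ey _ _]]]].
  by move=> wx; rewrite inE => /eqP ewy; apply/esym/sub; rewrite // -ewy.
rewrite ex ey !inE => wx wy.
have up_w u u' : (if blocks_up u then twin u' u else twin u u') ->
    (w == u) || (w == u') -> blocks_up w = blocks_up u.
  move=> tu /orP[]/eqP->//.
  by case: ifP tu => up /blocks_up_twin; rewrite up.
have := up_w _ _ tx wx; rewrite (up_w _ _ ty wy) => up.
move: tx ty; rewrite up; case: (blocks_up x) => tx ty.
  case/orP: wx wy => /eqP-> /orP[] /eqP e //.
  - by move: ty; rewrite -e => /alternate_twin; rewrite xA yA.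
  - by move: tx; rewrite e => /alternate_twin; rewrite xA yA.
  - by rewrite -e in ty; apply: twin_succ_uniq tx ty.
case/orP: wx wy => /eqP-> /orP[] /eqP e //.
- by move: ty; rewrite -e => /alternate_twin; rewrite xA yA.
- by move: tx; rewrite e => /alternate_twin; rewrite xA yA.
- by rewrite -e in ty; apply: twin_pred_uniq tx ty.
Qed.

(** * Choosing the reversed set *)

(** The minimal co-modules not handled by [alternate]; by [mc_meet] they are disjoint from every
    other minimal co-module. *)
Definition big M := [&& M \in MC, #|M| != 1 & ~~ ((#|M| == 2) && module M)].

Lemma big_mc M : big M -> M \in MC. Proof. by case/and3P. Qed.

Lemma mc_meet_big M N w : big M -> N \in MC -> w \in M -> w \in N -> M = N.
Proof.
case/and3P=> hM _ h2 hN wM wN; apply: contraNeq h2 => nMN.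
exact: mc_meet hM hN nMN wM wN.
Qed.

Lemma big_gt1 M : big M -> 1 < #|M|.
Proof.
case/and3P=> hM n1 _; rewrite ltn_neqAle eq_sym n1.
by have [x xM] := comod_neq0 (mc_comod hM); apply/card_gt0P; exists x.
Qed.

Lemma big_isolated M x : big M -> x \in M -> ~~ comod [set x].
Proof.
move=> bM xM; apply/negP=> cx; move: (big_gt1 bM).
by rewrite (mc_isolated (big_mc bM) xM cx) cards1.
Qed.

Lemma pair_eq M u v : 1 < #|M| -> M \subset [set u; v] ->
  M = [set u; v] /\ u != v.
Proof.
move=> gt1 sM; have le2 : #|[set u; v]| <= #|M|.
  by rewrite (leq_trans _ gt1) // cards2; case: (u != v).
split; first by apply/eqP; rewrite eqEcard sM.
by move: (leq_trans gt1 (subset_leq_card sM)); rewrite cards2; case: (u != v).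
Qed.

Lemma big_not_pair u v : module [set u; v] -> ~~ big [set u; v].
Proof.
move=> m; apply/negP=> b; case/and3P: (b) => _ n1; rewrite m andbT.
by move: n1; rewrite cards2; case: (u != v).
Qed.

(** A minimal co-module inside {v, u} cannot contain v, as it would then be M and make M a pair of
    twins; so it is {u}. *)
Lemma big_twin M u v : big M -> v \in M -> u != v -> module [set v; u] ->
  comod [set u] /\ u \notin M.
Proof.
move=> bM vM nuv m.
have nvu : v != u by rewrite eq_sym.
have [D hD sD] := comod_mc (nontriv_comod (pair_nontriv nvu m)).
have vD : v \notin D.
  apply/negP=> vD; have eMD := mc_meet_big bM hD vM vD.
  rewrite -eMD in sD; have [eM _] := pair_eq (big_gt1 bM) sD.
  by move: bM; rewrite eM (negbTE (big_not_pair m)).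
have cu : comod [set u].
  suff <- : D = [set u] by apply: mc_comod.
  have [w wD] := comod_neq0 (mc_comod hD).
  have Du z : z \in D -> z = u.
    move=> zD; have := subsetP sD _ zD; rewrite !inE => /orP[]/eqP // ezv.
    by rewrite -ezv zD in vD.
  apply/setP=> z; rewrite inE; apply/idP/eqP=> [/Du//|->].
  by rewrite -(Du w).
by split=> //; apply: contraL cu; apply: big_isolated.
Qed.

Definition untwinned v := [forall u, (u != v) ==> ~~ module [set v; u]].

(** Otherwise [big_twin] gives each vertex of M a twin outside M that is a source or a sink, and
    [sep] shows that distinct vertices of M get opposite types. *)
Lemma big_untwinned M : big M -> exists2 v, v \in M & untwinned v.
Proof.
move=> bM; apply/exists_inP; apply: contraT => /exists_inPn h.
have tw v : v \in M -> exists u eps,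
    [/\ u != v, module [set v; u], u \notin M
      & forall w, w != u -> T u w = eps].
  move=> vM; move: (h v vM); rewrite negb_forall => /existsP[u].
  rewrite negb_imply negbK => /andP[nuv m].
  have [cu uM] := big_twin bM vM nuv m.
  by have [eps heps] := isolated_arc cu; exists u, eps.
have sep v1 v2 u1 u2 eps1 eps2 : v1 \in M -> v2 \in M -> v1 != v2 ->
    module [set v1; u1] -> module [set v2; u2] -> u1 \notin M -> u2 \notin M ->
    (forall w, w != u1 -> T u1 w = eps1) ->
    (forall w, w != u2 -> T u2 w = eps2) -> eps2 = ~~ eps1.
  move=> v1M v2M nv m1 m2 u1M u2M h1 h2.
  have nMu v u : v \in M -> u \notin M -> v != u.
    by move=> vM; apply: contraNneq => <-.
  have [eu|nu] := eqVneq u1 u2; last first.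
    have nu' : u2 != u1 by rewrite eq_sym.
    by rewrite -(h1 u2) // (arcN nu) negbK h2.
  subst u2; have nv' : v2 != v1 by rewrite eq_sym.
  have [nv1 nv2] := (nMu _ _ v1M u1M, nMu _ _ v2M u1M).
  have e21 : T v2 v1 = ~~ eps1 by rewrite (pairP _ _ m1) // (arcN nv2) h1.
  have e12 : T v1 v2 = ~~ eps2 by rewrite (pairP _ _ m2) // (arcN nv1) h2.
  by move: (arcN nv); rewrite e12 e21 negbK => <-; rewrite negbK.
have [v1 [v2 [v1M v2M nv]]] := card_gt1P (big_gt1 bM).
have [u1 [eps1 [nu1 m1 u1M h1]]] := tw _ v1M.
have [u2 [eps2 [nu2 m2 u2M h2]]] := tw _ v2M.
have e2 := sep _ _ _ _ _ _ v1M v2M nv m1 m2 u1M u2M h1 h2.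
have nMu v u : v \in M -> u \notin M -> v != u.
  by move=> vM; apply: contraNneq => <-.
(* Were M a module, it would have a third vertex, not being a pair of twins; three types cannot be
   pairwise opposite. *)
have tC : nontriv (~: M).
  case/orP: (mc_comod (big_mc bM)) => // /nontriv_module mM.
  have [eM|[v3]] := set_0Vmem (M :\: [set v1; v2]).
    have sM : M \subset [set v1; v2] by rewrite -setD_eq0 eM.
    have [e _] := pair_eq (big_gt1 bM) sM.
    by rewrite e in bM mM; rewrite (negbTE (big_not_pair mM)) in bM.
  rewrite !inE negb_or => /andP[/andP[n31 n32] v3M].
  have [u3 [eps3 [nu3 m3 u3M h3]]] := tw _ v3M.
  rewrite eq_sym in n31; rewrite eq_sym in n32.
  have := sep _ _ _ _ _ _ v1M v3M n31 m1 m3 u1M u3M h1 h3.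
  rewrite (sep _ _ _ _ _ _ v2M v3M n32 m2 m3 u2M u3M h2 h3) e2.
  by case: eps1 {h1 e2}.
(* One of u1, u2 is a source and the other a sink, so v1 does separate them. *)
have : T v1 u1 = T v1 u2.
  by apply: (moduleP _ _ (nontriv_module tC)); rewrite ?inE ?negbK.
have [nv11 nv12] := (nMu _ _ v1M u1M, nMu _ _ v1M u2M).
rewrite (arcN nv11) (arcN nv12) h1 // h2 // e2.
by case: eps1 {h1 e2}.
Qed.

(** All that the count of X and the study of Inv(T,X) use about X; stated abstractly so as to apply
    again after a point has been moved inside its block. *)
Record good X (G : V -> {set V}) : Prop := Good {
  good_mc : forall x, x \in X -> G x \in MC;
  good_mem : forall x, x \in X -> x \in G x;
  good_disjoint : forall x y w,
    x \in X -> y \in X -> w \in G x -> w \in G y -> x = y;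
  good_hits : forall D, comod D -> exists2 x, x \in X & x \in D;
  good_nontriv : forall N, nontriv N -> ~~ (N \subset X) }.

Definition pick_untwinned M := [pick v in M | untwinned v].

Lemma pick_untwinnedP M : big M ->
  exists v, [/\ pick_untwinned M = Some v, v \in M & untwinned v].
Proof.
move=> /big_untwinned[v vM fv]; rewrite /pick_untwinned.
case: pickP => [u /andP[uM fu]|/(_ v)]; first by exists u.
by rewrite vM fv.
Qed.

Lemma good_exists : exists X G, good X G.
Proof.
(* One representative per big co-module; picking it as a function of M makes it unique. *)
pose C : {set V} := [set v | [exists M, big M && (pick_untwinned M == Some v)]].
have CP v : v \in C -> exists M,
    [/\ big M, pick_untwinned M = Some v, v \in M & untwinned v].
  rewrite inE => /existsP[M /andP[bM /eqP eM]]; exists M.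
  by have [u [eu uM fu]] := pick_untwinnedP bM; move: eu; rewrite eM => -[->].
(* The default [setT] is never reached on X: outside [alternate], a point of X lies in a big
   co-module. *)
pose G x := if x \in alternate then block x
            else odflt setT [pick M | big M && (x \in M)].
have GC x M : x \notin alternate -> x \in M -> big M -> G x = M.
  move=> nxA xM bM; rewrite /G (negbTE nxA).
  case: pickP => [N /andP[bN xN]|/(_ M)]; last by rewrite bM xM.
  by apply/esym/(mc_meet_big bM (big_mc bN) xM).
have blockN x : x \in alternate -> ~~ big (block x).
  case/block_cases=> [[_ ->]|[_ [w [_ -> _ m]]]]; last exact: big_not_pair.
  by rewrite /big cards1 andbF.
have altN x M : x \in alternate -> x \in M -> ~~ big M.
  move=> xA xM; apply/negP=> bM; case/negP: (blockN x xA).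
  by rewrite -(mc_meet_big bM (block_mc xA) xM (mem_block xA)).
pose X := alternate :|: C.
have XP x : x \in X -> (x \in alternate /\ G x = block x) \/
    [/\ x \notin alternate, big (G x), x \in G x, pick_untwinned (G x) = Some x
      & untwinned x].
  rewrite inE; case: (boolP (x \in alternate)) => [xA _|nxA /= xC].
    by left; rewrite /G xA.
  by have [M [bM eM xM fx]] := CP _ xC; right; rewrite (GC x M).
have Gmc x : x \in X -> G x \in MC.
  by case/XP=> [[xA ->]|[_ /big_mc]//]; apply: block_mc.
have Gmem x : x \in X -> x \in G x.
  by case/XP=> [[xA ->]|[]//]; apply: mem_block.
have pairX x y : x \in X -> y \in X -> x != y -> ~~ module [set x; y].
  move=> xX yX nxy; have nyx : y != x by rewrite eq_sym.
  case: (XP x xX) => [[xA _]|[_ _ _ _ /forallP/(_ y)]]; last by rewrite nyx.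
  case: (XP y yX) => [[yA _]|[_ _ _ _ /forallP/(_ x)]]; last first.
    by rewrite nxy setUC.
  by apply/negP=> /(alternate_pair nxy); rewrite xA yA.
have bigX M : big M -> ~~ (M \subset X).
  move=> bM; apply/negP=> /subsetP sM.
  have GM x : x \in M -> pick_untwinned M = Some x.
    move=> xM; case: (XP x (sM x xM)) => [[xA _]|[nxA _ _ <- _]].
      by move: bM; rewrite (negbTE (altN x M xA xM)).
    by rewrite (GC x M).
  have [x [y [xM yM]]] := card_gt1P (big_gt1 bM).
  by move: (GM x xM); rewrite (GM y yM) => -[->]; rewrite eqxx.
exists X, G; split=> //.
- move=> x y w xX yX.
  case: (XP x xX) => [[xA ex]|[nxA bx xG px _]];
  case: (XP y yX) => [[yA ey]|[nyA by_ yG py _]].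
  + by rewrite ex ey; apply: block_disjoint.
  + move=> wx wy; have e := mc_meet_big by_ (Gmc x xX) wy wx.
    by move: by_; rewrite e ex (negbTE (blockN x xA)).
  + move=> wx wy; have e := mc_meet_big bx (Gmc y yX) wx wy.
    by move: bx; rewrite e ey (negbTE (blockN y yA)).
  + move=> wx wy; have e := mc_meet_big bx (Gmc y yX) wx wy.
    by move: px; rewrite e py => -[->].
- move=> D cD; have [M hM /subsetP sM] := comod_mc cD.
  suff [x xX xM] : exists2 x, x \in X & x \in M by exists x => //; apply: sM.
  have [bM|] := boolP (big M).
    have [v [eM vM _]] := pick_untwinnedP bM; exists v => //.
    by rewrite !inE; apply/orP; right; apply/existsP; exists M; rewrite bM eM /=.
  rewrite /big hM /= negb_and !negbK => /orP[/cards1P[x ex]|/andP[/cards2P[x [y [nxy ->]]] m]].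
    exists x; last by rewrite ex set11.
    by rewrite inE isolated_alternate // -ex mc_comod.
  have := alternate_pair nxy m; case: (boolP (y \in alternate)) => yA xA.
    by exists y; rewrite ?set22 // inE yA.
  by exists x; rewrite ?set21 // inE xA.
(* Shrink to a minimal nontrivial module N inside X. A minimal co-module inside N can be neither big
   nor a pair of twins, so it is {x} with x a source or a sink. As N has a third vertex, N minus x
   is again a nontrivial module, against minimality. *)
move=> N0 tN0; apply/negP=> sN0.
have [N /minsetP[tN minN] sN] := minset_exists (P := nontrivial_module T) tN0.
have {sN0 sN} sNX := subset_trans sN sN0.
have not2 x y : x \in N -> y \in N -> x != y -> N != [set x; y].
  move=> xN yN nxy; apply: contraTneq (pairX x y _ _ nxy) => [e||].
  - by rewrite negbK -e nontriv_module.
  - exact: subsetP sNX _ xN.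
  - exact: subsetP sNX _ yN.
have [D hD sD] := comod_mc (nontriv_comod tN).
have [bD|] := boolP (big D).
  by case/negP: (bigX D bD); apply: subset_trans sNX.
rewrite /big hD /= negb_and !negbK => /orP[/cards1P[x ex]|/andP[/cards2P[x [y [nxy eD]]] m]]; last first.
  have xN : x \in N by rewrite (subsetP sD) // eD set21.
  have yN : y \in N by rewrite (subsetP sD) // eD set22.
  have [xX yX] := (subsetP sNX _ xN, subsetP sNX _ yN).
  by case/negP: (pairX x y xX yX nxy); rewrite -eD.
have xN : x \in N by rewrite (subsetP sD) // ex set11.
have cx : comod [set x] by rewrite -ex mc_comod.
have [eps heps] := isolated_arc cx.
have [y yN nyx] := nontriv_other x tN.
have [eN|[z]] := set_0Vmem (N :\: [set x; y]).
  have sN : N \subset [set x; y] by rewrite -setD_eq0 eN.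
  have gt1 : 1 < #|N| by move: tN; rewrite nontrivE => /and3P[].
  have nxy : x != y by rewrite eq_sym.
  by case: (pair_eq gt1 sN) => e _; move: (not2 x y xN yN nxy); rewrite e eqxx.
rewrite !inE negb_or => /andP[/andP[nzx nzy] zN].
have tNx : nontriv (N :\ x).
  apply: (@nontrivI _ y z x); rewrite ?inE ?nyx ?nzx ?eqxx //; last by rewrite eq_sym.
  apply/moduleP=> a b v; rewrite !inE negb_and negbK => /andP[na aN] /andP[nb bN].
  case/orP=> [/eqP->|vN]; first by rewrite !heps.
  exact: (moduleP _ _ (nontriv_module tN)).
have := minN _ tNx (subsetDl _ _); move/setP/(_ x).
by rewrite !inE eqxx xN.
Qed.

(** * Hitting sets of co-modules and the co-modular index *)

Lemma comod_disjoint_decomposable X D :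
  comod D -> [disjoint X & D] -> ~~ indecomposable (Inv T X).
Proof.
move=> cD dXD; apply/forallP=> ind; case/orP: cD => tD.
  have := ind D; rewrite Inv_module ?dXD // nontriv_module //=.
  by case/andP: tD => _ /negbTE->.
have := ind (~: D); rewrite Inv_module ?nontriv_module //=; last first.
  by rewrite -disjoints_subset dXD orbT.
by case/andP: tD => _ /negbTE->.
Qed.

(** Choosing a point of X in each member of a disjoint family of co-modules is injective. *)
Lemma comodular_index_le X :
  (forall D, comod D -> exists2 x, x \in X & x \in D) ->
  comodular_index T <= #|X|.
Proof.
move=> hitX; apply/bigmax_leqP=> P /andP[/forall_inP cP /trivIsetP dP].
have [x0 _] : exists x, x \in [set: V].
  by apply/set0Pn; rewrite -card_gt0 cardsT (leq_trans _ order_ge5).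
pose f M := odflt x0 [pick x in X | x \in M].
have fP M : M \in P -> (f M \in X) && (f M \in M).
  move=> MP; rewrite /f; case: pickP => [x //|none].
  by have [x xX xM] := hitX M (cP M MP); have := none x; rewrite xX xM.
have inj_f : {in P &, injective f}.
  move=> M N MP NP eMN; apply/eqP/negPn/negP=> nMN.
  have [/andP[_ fM] /andP[_ fN]] := (fP M MP, fP N NP).
  by move/pred0P: (dP M N MP NP nMN) => /(_ (f M)) /=; rewrite fM eMN fN.
rewrite -(card_in_imset inj_f); apply: subset_leq_card.
by apply/subsetP=> _ /imsetP[M MP ->]; case/andP: (fP M MP).
Qed.

Lemma good_uniq X G x y : good X G -> x \in X -> y \in X -> y \in G x -> y = x.
Proof. by move=> gX xX yX yx; apply: (good_disjoint gX yX xX (good_mem gX yX) yx). Qed.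

(** The blocks G x form a family of |X| disjoint co-modules, which attains the bound given by
    hitting. *)
Lemma good_card X G : good X G -> #|X| = comodular_index T.
Proof.
move=> gX; apply/eqP; rewrite eqn_leq (comodular_index_le (good_hits gX)) andbT.
have inj_G : {in X &, injective G}.
  move=> x y xX yX e; apply: (good_disjoint gX xX yX (good_mem gX xX)).
  by rewrite -e; apply: good_mem gX _ xX.
rewrite -(card_in_imset inj_G).
apply: (@leq_bigmax_cond _ _ (fun P : {set {set V}} => #|P|)).
apply/andP; split.
  apply/forall_inP=> _ /imsetP[x xX ->]; apply: mc_comod.
  exact: good_mc gX _ xX.
apply/trivIsetP=> _ _ /imsetP[x xX ->] /imsetP[y yX ->] nG.
apply/pred0P=> w /=; apply/negbTE/negP=> /andP[wx wy].
by rewrite (good_disjoint gX xX yX wx wy) eqxx in nG.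
Qed.

Lemma good_cover X G : good X G -> X \subset cover MC.
Proof.
move=> gX; apply/subsetP=> x xX; apply/bigcupP.
by exists (G x); [apply: good_mc gX _ xX | apply: good_mem gX _ xX].
Qed.

Lemma good_nontriv_hit X G D : good X G -> nontriv D -> ~~ [disjoint X & D].
Proof.
move=> gX /nontriv_comod/(good_hits gX)[x xX xD].
by apply/pred0Pn; exists x; rewrite /= xX.
Qed.

Lemma neq_mem (A : {set V}) x y : x \in A -> y \notin A -> x != y.
Proof. by move=> xA; apply: contraNneq => <-. Qed.

(** * Modules after reversal *)

Section InvModule.

Variables (X M : {set V}) (G : V -> {set V}).
Hypothesis gX : good X G.
Hypothesis modM : is_module (Inv T X) M.

Lemma Inv_out d m m' :
  m \in M -> m' \in M -> d \notin M -> d \notin X -> T d m = T d m'.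
Proof.
move=> mM m'M dM dX; have := moduleP _ _ modM m m' d mM m'M dM.
by rewrite /Inv (negbTE dX).
Qed.

(** Only the arc between c and a is reversed, so in T the vertex c must separate a from b. *)
Lemma Inv_flip a b c : a \in M -> a \in X -> b \in M -> b \notin X ->
  c \notin M -> c \in X -> T c b = T a c.
Proof.
move=> aM aX bM bX cM cX; have := moduleP _ _ modM b a c bM aM cM.
by rewrite /Inv cX aX (negbTE bX).
Qed.

Lemma block_out x y : x \in X -> y \in X -> y != x -> y \notin G x.
Proof. by move=> xX yX; apply: contraNN => /(good_uniq gX xX yX)->. Qed.

Lemma block_notin x g : x \in X -> g \in G x -> g != x -> g \notin X.
Proof.
move=> xX gG; apply: contraNN => gX'; apply/eqP; exact: good_uniq gX xX gX' gG.
Qed.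

Variables (a0 b0 c0 : V).
Hypotheses (a0M : a0 \in M) (a0X : a0 \in X).
Hypotheses (b0M : b0 \in M) (b0X : b0 \notin X).
Hypotheses (c0M : c0 \notin M) (c0X : c0 \in X).

(** By [Inv_flip], c separates a0 from b, both outside G c; so the complement of G c is no module
    and G c is one. Every g in G c then separates a0 from b as well, which [Inv_out] forbids for g
    outside M and X. *)
Lemma outer_block c b : c \in X -> c \notin M -> b \in M -> b \notin X ->
  b \notin G c ->
  nontriv (G c) /\ forall g, g \in G c -> g != c -> (g \in M) && (g \notin X).
Proof.
move=> cX cM bM bX bG.
have nac : a0 != c := neq_mem a0M cM.
have aG : a0 \notin G c := block_out cX a0X nac.
have fl := Inv_flip a0M a0X bM bX cM cX.
have cG := good_mem gX cX.
case/orP: (mc_comod (good_mc gX cX)) => tG; last first.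
  have : T c a0 = T c b.
    by apply: (moduleP _ _ (nontriv_module tG)); rewrite ?inE ?negbK.
  by rewrite fl (arcN nac); case: (T c a0).
split=> // g gG ngc; have gX' := block_notin cX gG ngc; rewrite gX' andbT.
apply/negPn/negP=> gM.
have ag : T g a0 = T c a0 by apply: module_arc (nontriv_module tG) _ _ _.
have bg : T g b = T c b by apply: module_arc (nontriv_module tG) _ _ _.
have := Inv_out a0M bM gM gX'; rewrite ag bg fl (arcN nac).
by case: (T c a0).
Qed.

(** If G a is a module, c0 does not separate its vertices, while it separates a from M \ X; so the
    rest of G a is outside M. Any such g sees all of M alike, and a agrees with g on M minus a. *)
Lemma inner_block a : a \in X -> a \in M ->
  (exists g, [/\ g \in G a, g \notin M, nontriv (G a)
     & forall m, m \in M -> m != a -> T a m = T g a])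
  \/ nontriv (~: G a).
Proof.
move=> aX aM; case/orP: (mc_comod (good_mc gX aX)) => tG; [left | by right].
have mG := nontriv_module tG; have aG := good_mem gX aX.
have nca : c0 != a by rewrite eq_sym (neq_mem aM).
have cG : c0 \notin G a := block_out aX c0X nca.
have outM g : g \in G a -> g != a -> g \notin M.
  move=> gG nga; apply/negP=> gM; have gX' := block_notin aX gG nga.
  have := Inv_flip aM aX gM gX' c0M c0X.
  rewrite (moduleP _ _ mG g a c0 gG aG cG) (arcN nca).
  by case: (T a c0).
have [g gG nga] := nontriv_other a tG; have gM := outM g gG nga.
exists g; split=> // m mM nma.
have mG' : m \notin G a by apply: contraL mM => /outM; apply.
rewrite (module_arc mG aG gG mG'); apply: Inv_out => //.
exact: block_notin aX gG nga.
Qed.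

(** Both blocks contain vertices b, b' of M \ X and are modules, so the arc between b and b' forces
    a0 to separate c from c'. Applied to a0, [inner_block] says that it does not. *)
Lemma no_two_outer c c' :
  c \in X -> c \notin M -> c' \in X -> c' \notin M -> c = c'.
Proof.
move=> cX cM c'X c'M; apply/eqP/negPn/negP=> ncc'.
have nc'c : c' != c by rewrite eq_sym.
have inner x : x \in X -> x \notin M -> exists b, [/\ b \in M, b \notin X & b \in G x].
  move=> xX xM; have [bG|bG] := boolP (b0 \in G x); first by exists b0.
  have [tG inG] := outer_block xX xM b0M b0X bG.
  by have [g gG ngx] := nontriv_other x tG; exists g; case/andP: (inG g gG ngx).
have [b [bM bX bG]] := inner c cX cM.
have [b' [b'M b'X b'G]] := inner c' c'X c'M.
have bG' : b \notin G c'.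
  by apply/negP=> bG'; rewrite (good_disjoint gX cX c'X bG bG') eqxx in ncc'.
have b'G' : b' \notin G c.
  by apply/negP=> b'G'; rewrite (good_disjoint gX cX c'X b'G' b'G) eqxx in ncc'.
have [/nontriv_module mG _] := outer_block cX cM b'M b'X b'G'.
have [/nontriv_module mG' _] := outer_block c'X c'M bM bX bG'.
have [cG c'G] := (good_mem gX cX, good_mem gX c'X).
have [nac nac'] := (neq_mem a0M cM, neq_mem a0M c'M).
have ab : T a0 b = T a0 c := moduleP _ _ mG _ _ _ bG cG (block_out cX a0X nac).
have ab' : T a0 b' = T a0 c' :=
  moduleP _ _ mG' _ _ _ b'G c'G (block_out c'X a0X nac').
have nbb' := neq_mem bG b'G'.
have bb' : T b b' = T a0 c.
  by rewrite (module_arc mG bG cG b'G') (Inv_flip a0M a0X).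
have b'b : T b' b = T a0 c'.
  by rewrite (module_arc mG' b'G c'G bG') (Inv_flip a0M a0X).
have ecc' : T a0 c = ~~ T a0 c' by rewrite -bb' -b'b arcN.
have [nba nb'a] : b != a0 /\ b' != a0 by split; rewrite eq_sym (neq_mem a0X).
case: (inner_block a0X a0M) => [[g [_ _ _ h]]|tG].
  by move: ecc'; rewrite -ab -ab' !h //; case: (T g a0).
have e : T a0 c = T a0 c'.
  apply: (moduleP _ _ (nontriv_module tG)); rewrite ?inE ?negbK ?(good_mem gX) //.
    by apply: block_out; rewrite // eq_sym.
  by apply: block_out; rewrite // eq_sym.
by move: ecc'; rewrite e; case: (T a0 c').
Qed.

(** In each case the arc from one point of M & X to another equals its arc to a reference vertex,
    which makes the two directions between a and a' clash. *)
Lemma no_two_inner a a' :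
  a \in X -> a \in M -> a' \in X -> a' \in M -> a = a'.
Proof.
move=> aX aM a'X a'M; apply/eqP/negPn/negP=> naa'.
have na'a : a' != a by rewrite eq_sym.
have flip x : x \in X -> x \in M -> T c0 b0 = T x c0.
  by move=> xX xM; apply: Inv_flip.
have cG x : x \in X -> x \in M -> c0 \notin G x.
  by move=> xX xM; apply: block_out; rewrite // eq_sym (neq_mem xM).
(* If b0 is outside G c0, that block is a module meeting M, and c0 serves as reference: all inner
   points have the same arc to it. *)
have [bG|bG] := boolP (b0 \in G c0); last first.
  have [tG inG] := outer_block c0X c0M b0M b0X bG.
  have [g gG ngc] := nontriv_other c0 tG; have /andP[gM gX'] := inG g gG ngc.
  have arc x y : x \in X -> x \in M -> y \in X -> y \in M -> y != x ->
      T x y = T c0 b0.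
    move=> xX xM yX yM nyx; rewrite (flip x) //.
    case: (inner_block xX xM) => [[h [_ _ _ hh]]|tx].
      have ngx : g != x by rewrite eq_sym (neq_mem xX).
      rewrite hh // -(hh g) //.
      apply: (moduleP _ _ (nontriv_module tG)); rewrite ?(good_mem gX) //.
      by apply: block_out; rewrite // (neq_mem xM).
    apply: (moduleP _ _ (nontriv_module tx)); rewrite ?inE ?negbK ?(good_mem gX) ?cG //.
    exact: block_out.
  have := arcN naa'; rewrite (arc a a') // (arc a' a) //.
  by case: (T c0 b0).
have bGx x : x \in X -> x \in M -> b0 \notin G x.
  move=> xX xM; apply/negP=> bx; move: c0M.
  by rewrite (good_disjoint gX c0X xX bG bx) xM.
have nb x : x \in X -> b0 != x by move=> xX; rewrite eq_sym (neq_mem xX).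
have arc x y : x \in X -> x \in M -> y \in X -> y \in M -> y != x ->
    T x y = T x b0.
  move=> xX xM yX yM nyx; case: (inner_block xX xM) => [[h [_ _ _ hh]]|tx].
    by rewrite !hh // nb.
  apply: (moduleP _ _ (nontriv_module tx)); rewrite ?inE ?negbK ?(good_mem gX) ?bGx //.
  exact: block_out.
(* Here b0 is the reference, so a and a' have different arcs to b0. This shows that they then also
   have different arcs to c0, against [flip]. *)
have key x y : x \in X -> x \in M -> y \in X -> y \in M -> y != x ->
    T x b0 != T y b0 -> T x b0 = T x c0.
  move=> xX xM yX yM nyx nxy; case: (inner_block xX xM) => [[g [gG gM tx _]]|tx]; last first.
    by apply: (moduleP _ _ (nontriv_module tx)); rewrite ?inE ?negbK ?(good_mem gX) ?bGx ?cG.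
  have mx := nontriv_module tx; have xG := good_mem gX xX.
  have <- : T g c0 = T x c0 by apply: (module_arc mx); rewrite ?cG.
  have <- : T g b0 = T x b0 by apply: (module_arc mx); rewrite ?bGx.
  have ncx : c0 != x by rewrite eq_sym (neq_mem xM).
  have gc : g \notin G c0.
    by apply/negP=> gc; rewrite (good_disjoint gX c0X xX gc gG) eqxx in ncx.
  case/orP: (mc_comod (good_mc gX c0X)) => tG.
    by apply: (moduleP _ _ (nontriv_module tG)); rewrite ?(good_mem gX).
  have nyc : y != c0 by rewrite (neq_mem yM).
  have xyb : T b0 x = T b0 y.
    apply: (moduleP _ _ (nontriv_module tG)); rewrite ?inE ?negbK //.
      by apply: block_out; rewrite // eq_sym.
    by apply: block_out.
  have nbx := nb x xX; have nby := nb y yX; rewrite eq_sym in nbx; rewrite eq_sym in nby.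
  by rewrite (arcN nbx) (arcN nby) xyb eqxx in nxy.
have nab : T a b0 != T a' b0.
  by have := arcN naa'; rewrite (arc a a') // (arc a' a) //; case: (T a' b0) => ->.
move: (nab); rewrite (key a a') // (key a' a) ?(eq_sym (T a' b0)) //.
by rewrite -flip // -flip // eqxx.
Qed.

End InvModule.

(* The two obstructions when X = {p, q} and q lies in the block Q, p in P.
   [twins_but]: p and some b in Q become twins in Inv(T,X).
   [isolated_but]: p becomes a source or a sink of Inv(T,X); then V \ {p} is
   a module of it. *)
Definition twins_but (Q : {set V}) p q := [exists b in Q, (b != q) &&
  [forall v, (v != p) ==> (v != b) ==> ((T v p != T v b) == (v == q))]].

Definition isolated_but (P : {set V}) p q :=
  [&& #|P| == 2, module P
    & [forall v, (v != p) ==> (v != q) ==> (T p v == T q p)]].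

Lemma twins_butP (Q : {set V}) p q :
  reflect (exists b, [/\ b \in Q, b != q
    & forall v, v != p -> v != b -> (T v p != T v b) = (v == q)])
    (twins_but Q p q).
Proof.
apply: (iffP exists_inP) => [[b bQ /andP[nbq /forallP h]]|[b [bQ nbq h]]].
  exists b; split=> // v nvp nvb.
  by move: (h v); rewrite nvp nvb => /eqP.
exists b; rewrite ?nbq //=; apply/forallP=> v.
by apply/implyP=> nvp; apply/implyP=> nvb; apply/eqP/h.
Qed.

Lemma isolated_butP (P : {set V}) p q :
  reflect [/\ #|P| = 2, module P
    & forall v, v != p -> v != q -> T p v = T q p] (isolated_but P p q).
Proof.
apply: (iffP and3P) => -[c m h]; split=> //; first exact/eqP.
- by move=> v nvp nvq; move/forallP/(_ v): h; rewrite nvp nvq => /eqP.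
- exact/eqP.
apply/forallP=> v; apply/implyP=> nvp; apply/implyP=> nvq; apply/eqP.
exact: h.
Qed.

Lemma good_obstruction X G : good X G -> ~~ indecomposable (Inv T X) ->
  exists p q, [/\ p != q, X = [set p; q] &
    twins_but (G q) p q || isolated_but (G p) p q].
Proof.
move=> gX; rewrite negb_forall => /existsP[M]; rewrite negb_imply => /andP[mM ntM].
have tM : module M -> nontriv M by move=> m; rewrite /nontrivial_module m.
have [dX|/pred0Pn[a /andP[/= aX aM]]] := boolP [disjoint X & M].
  have mTM : module M by rewrite -(@Inv_module _ _ M X) // dX.
  by move: (good_nontriv_hit gX (tM mTM)); rewrite dX.
have [sX|/subsetPn[c cX cM]] := boolP (X \subset M).
  have mTM : module M by rewrite -(@Inv_module _ _ M X) // sX orbT.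
  have [x xX] := good_hits gX (D := ~: M) (etrans (comodC M) (nontriv_comod (tM mTM))).
  by rewrite inE (subsetP sX).
(* If M is inside X, an outside vertex has either all or none of its arcs to M reversed, so M is a
   module of T contained in X. *)
have [sM|/subsetPn[b bM bX]] := boolP (M \subset X).
  have : nontriv M.
    apply: tM; apply/moduleP=> x y v xM yM vM.
    have [nxv nyv] := (neq_mem xM vM, neq_mem yM vM).
    have := moduleP _ _ mM x y v xM yM vM.
    rewrite /Inv (subsetP sM x xM) (subsetP sM y yM) !andbT (arcN nxv) (arcN nyv).
    by case: ifP => // _ /negb_inj.
  by move/(good_nontriv gX); rewrite sM.
have eX : X = [set a; c].
  apply/setP=> x; rewrite !inE; apply/idP/orP=> [xX|[]/eqP->//].
  have [xM|xM] := boolP (x \in M); [left|right]; apply/eqP.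
    exact: (no_two_inner gX mM aM aX bM bX cM cX).
  exact: (no_two_outer gX mM aM aX bM bX cM cX).
have nac := neq_mem aM cM; have nca : c != a by rewrite eq_sym.
suff [tw|iso] : twins_but (G c) a c \/ isolated_but (G c) c a.
- by exists a, c; rewrite tw.
- by exists c, a; rewrite iso orbT setUC.
have notX m : m != a -> m != c -> m \notin X by rewrite eX !inE negb_or => -> ->.
have MX m : m \in M -> m != a -> m \notin X.
  by move=> mM' nma; apply: notX => //; apply: neq_mem mM' cM.
have flip m : m \in M -> m != a -> T c m = T a c.
  by move=> mM' nma; apply: (Inv_flip mM); rewrite ?MX.
have nba : b != a by rewrite eq_sym (neq_mem aX).
(* If M minus a is inside G c, it is a module of T missing X, hence a single vertex b, the future
   twin of a. Otherwise G c is a module, and c will be the isolated vertex. *)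
have [sB|[b1]] := set_0Vmem ((M :\ a) :\: G c).
  have inG m : m \in M -> m != a -> m \in G c.
    by move=> mM' nma; move/setP/(_ m): sB; rewrite !inE mM' nma !andbT => /negbFE.
  have const m m' : m \in M -> m != a -> m' \in M -> m' != a -> T a m = T a m'.
    move=> mM' nma m'M nm'a.
    case: (inner_block gX mM cM cX aX aM) => [[g [_ _ _ h]]|tG]; first by rewrite !h.
    have out v : v \in M -> v != a -> v \notin G a.
      move=> vM nva; apply/negP=> va; move: nac.
      by rewrite (good_disjoint gX aX cX va (inG v vM nva)) eqxx.
    by apply: (moduleP _ _ (nontriv_module tG)); rewrite ?inE ?negbK ?out ?(good_mem gX).
  have uniqb m : m \in M -> m != a -> m = b.
    move=> mM' nma; apply/eqP/negPn/negP=> nmb.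
    have /(good_nontriv_hit gX)/pred0Pn[x /=] : nontriv (M :\ a).
      apply: (@nontrivI _ m b a); rewrite ?inE ?nma ?nba ?eqxx //.
      apply/moduleP=> x y v; rewrite !inE negb_and negbK.
      move=> /andP[nxa xM] /andP[nya yM] vM.
      have [->|nva] := eqVneq v a; first exact: const.
      rewrite (negbTE nva) /= in vM.
      have [->|nvc] := eqVneq v c; first by rewrite !flip.
      by apply: (Inv_out mM); rewrite ?notX.
    rewrite !inE eX !inE => /andP[/orP[]/eqP->]; first by rewrite eqxx.
    by rewrite (negbTE cM) andbF.
  left; apply/twins_butP; exists b; split; [exact: inG | exact: neq_mem bM cM |].
  move=> v nva nvb; have vM : v \notin M by apply: contra nvb => /uniqb->.
  have [->|nvc] := eqVneq v c.
    by rewrite (flip b) // (arcN nca); case: (T a c).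
  by rewrite (Inv_out mM aM bM) ?notX ?eqxx.
rewrite !inE => /andP[b1G /andP[nb1a b1M]].
have [tG inG] := outer_block gX mM aM aX cX cM b1M (MX _ b1M nb1a) b1G.
have mG := nontriv_module tG.
have [g gG ngc] := nontriv_other c tG.
have aG : a \notin G c := block_out gX cX aX nac.
have inG' x : x \in G c -> x != c -> (x \in M) && (x != a).
  by move=> xG nxc; case/andP: (inG x xG nxc) => -> _; apply: neq_mem xG aG.
(* With a third vertex, G c minus c would be a nontrivial module missing X. *)
have eG : G c = [set c; g].
  apply/setP=> x; rewrite !inE; apply/idP/orP=> [xG|[]/eqP->//]; last exact: good_mem gX _ cX.
  have [->|nxc] := eqVneq x c; [by left | right].
  apply/negPn/negP=> nxg.
  have /(good_nontriv_hit gX)/pred0Pn[y /=] : nontriv (G c :\ c).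
    apply: (@nontrivI _ x g c); rewrite ?inE ?nxc ?ngc ?eqxx //.
    apply/moduleP=> y z v; rewrite !inE negb_and negbK.
    move=> /andP[nyc yG] /andP[nzc zG] vG.
    have [->|nvc] := eqVneq v c.
      have [/andP[yM nya] /andP[zM nza]] := (inG' y yG nyc, inG' z zG nzc).
      by rewrite !flip.
    by rewrite (negbTE nvc) /= in vG; apply: (moduleP _ _ mG).
  rewrite !inE eX !inE => /andP[/orP[]/eqP->]; last by rewrite eqxx.
  by rewrite (negbTE aG) andbF.
right; apply/isolated_butP; split=> //; first by rewrite eG cards2 (eq_sym c) ngc.
have /andP[gM nga] := inG' g gG ngc.
move=> v nvc nva; apply: flip => //; apply/negPn/negP=> vM.
(* An outside w sees M alike, and also c and g in M alike. The complement of this module is a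
   co-module that misses X. *)
have tcM : nontriv (c |: M).
  apply: (@nontrivI _ a c v); rewrite ?inE ?eqxx ?aM ?orbT // ?negb_or ?nvc //.
  apply/moduleP=> x y w; rewrite !inE negb_or => xcM ycM /andP[nwc wM].
  have all z : (z == c) || (z \in M) -> T w z = T w g.
    case/orP=> [/eqP->|zM].
      apply: (moduleP _ _ mG); rewrite ?(good_mem gX) // eG !inE negb_or nwc.
      by rewrite eq_sym (neq_mem gM).
    by apply: (Inv_out mM) => //; apply: notX => //; rewrite eq_sym (neq_mem aM).
  by rewrite !all.
have [x] := good_hits gX (D := ~: (c |: M)) (etrans (comodC _) (nontriv_comod tcM)).
by rewrite eX !inE => /orP[]/eqP->; rewrite ?eqxx ?aM ?orbT.
Qed.

(** Otherwise a could be added to the module ~M, making M minus a a smaller co-module. *)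
Lemma mc_separated M a b : M \in MC -> nontriv (~: M) -> 1 < #|M| ->
  a \in M -> b \notin M -> ~ (forall v, v \in M -> v != a -> T v a = T v b).
Proof.
move=> hM tM gt1 aM bM h.
have [c cM nca] := card_gt1_other a gt1.
have all x v : x \in a |: ~: M -> v \in M -> v != a -> T v x = T v b.
  rewrite !inE => /orP[/eqP->|xM] vM nva; first exact: h.
  by apply: (moduleP _ _ (nontriv_module tM)); rewrite ?inE ?negbK.
have t : nontriv (a |: ~: M).
  apply: (@nontrivI _ a b c); rewrite ?inE ?eqxx ?bM ?orbT ?negb_or ?nca ?cM //.
    apply/moduleP=> x y v xI yI; rewrite !inE negb_or negbK => /andP[nva vM].
    by rewrite !all.
  exact: neq_mem aM bM.
have : M :\ a = M.
  apply: (mc_min hM) (subsetDl _ _); apply: nontrivC_comod.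
  by rewrite setCD setUC.
by move/setP/(_ a); rewrite !inE eqxx aM.
Qed.

Lemma twins_but_isolated (Q : {set V}) p q eps :
  (forall v, v != p -> T p v = eps) -> p \notin Q -> q \in Q -> twins_but Q p q ->
  exists b, [/\ b \in Q, b != q
    & forall v, v != p -> v != b -> T b v = (v == q) (+) eps].
Proof.
move=> hp pQ qQ /twins_butP[b [bQ nbq h]]; exists b; split=> // v nvp nvb.
have nbv : b != v by rewrite eq_sym.
by move: (h v nvp nvb); rewrite (arcN nvp) hp // (arcN nbv) => <-; case: eps (T v b) {hp} => [] [].
Qed.

(** * Repairing two-element sets *)

Section Replace.

Variables (p q : V) (G : V -> {set V}).
Hypotheses (gX : good [set p; q] G) (npq : p != q).
Local Notation P := (G p).
Local Notation Q := (G q).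

Let pX : p \in [set p; q]. Proof. exact: set21. Qed.
Let qX : q \in [set p; q]. Proof. exact: set22. Qed.
Let pP : p \in P. Proof. exact: good_mem gX _ pX. Qed.
Let qQ : q \in Q. Proof. exact: good_mem gX _ qX. Qed.
Let PMC : P \in MC. Proof. exact: good_mc gX _ pX. Qed.
Let QMC : Q \in MC. Proof. exact: good_mc gX _ qX. Qed.

Let PQ x : x \in P -> x \notin Q.
Proof.
move=> xP; apply/negP=> xQ; move: npq.
by rewrite (good_disjoint gX pX qX xP xQ) eqxx.
Qed.

Let QP x : x \in Q -> x \notin P.
Proof. by apply: contraL => /PQ. Qed.

Let hit D : comod D -> (p \in D) || (q \in D).
Proof. by case/(good_hits gX)=> x; rewrite !inE => /orP[]/eqP-> ->; rewrite ?orbT. Qed.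

(** Isolation fails because p sees q and any other vertex of Q alike. If p and b become twins, P and
    Q together form a module, which must be V as its complement misses {p, q}. Then p joined to Q is
    a module too, and P minus p is a smaller co-module. *)
Lemma no_obstruction_modules :
  nontriv P -> nontriv Q -> ~~ (twins_but Q p q || isolated_but P p q).
Proof.
move=> tP tQ; have [mP mQ] := (nontriv_module tP, nontriv_module tQ).
have [p' p'P np'p] := nontriv_other p tP.
rewrite negb_or; apply/andP; split; last first.
  apply/negP=> /isolated_butP[_ _ h].
  have [q' q'Q nq'q] := nontriv_other q tQ.
  have nq'p : q' != p by rewrite eq_sym (neq_mem pP) ?PQ // (contraL (@PQ q')).
  have := h q' nq'p nq'q.
  rewrite (moduleP _ _ mQ q' q p q'Q qQ (PQ pP)) (arcN npq).
  by case: (T q p).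
apply/negP=> /twins_butP[b [bQ nbq h]].
have nbp : b != p by rewrite (neq_mem bQ) ?PQ.
have sepN v : v != p -> v != b -> v != q -> T v p = T v b.
  by move=> nvp nvb nvq; move: (h v nvp nvb); rewrite (negbTE nvq) => /negbFE/eqP.
have nPQ x y : x \in P -> y \in Q -> x != y.
  by move=> xP yQ; rewrite (neq_mem xP) ?QP.
have np'b := nPQ _ _ p'P bQ; have npp' : p != p' by rewrite eq_sym.
have nbp' : b != p' by rewrite eq_sym.
have bP x : x \in P -> T b x = T p p'.
  move=> xP; rewrite (moduleP _ _ mP x p' b xP p'P (QP bQ)).
  by rewrite (arcN nbp') (arcN npp') (sepN p' np'p np'b (nPQ _ _ p'P qQ)).
have QPa y x : y \in Q -> x \in P -> T y x = T p p'.
  by move=> yQ xP; rewrite (module_arc mQ yQ bQ (PQ xP)) bP.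
have tU : module (P :|: Q).
  have all x v : x \in P :|: Q -> v \notin P :|: Q -> T v x = T v p.
    rewrite !inE negb_or => /orP[xP|xQ] /andP[vP vQ]; first exact: (moduleP _ _ mP).
    have [nvp nvb] : v != p /\ v != b by split; [apply: contraNneq vP|apply: contraNneq vQ] => ->.
    have nvq : v != q by apply: contraNneq vQ => ->.
    by rewrite (sepN v) // (moduleP _ _ mQ x b).
  by apply/moduleP=> x y v xU yU vU; rewrite (all x) // (all y).
have full v : (v \in P) || (v \in Q).
  apply/negPn/negP; rewrite -in_setU => vU.
  have /nontriv_comod : nontriv (P :|: Q).
    by apply: (@nontrivI _ p q v) => //; rewrite !inE ?pP ?qQ ?orbT.
  by rewrite -comodC => /hit; rewrite !inE pP qQ orbT.
have pPa x : x \in P -> x != p -> T x p = ~~ T p p'.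
  move=> xP nxp; have nbx : b != x by rewrite eq_sym nPQ.
  by rewrite (sepN x nxp (nPQ _ _ xP bQ) (nPQ _ _ xP qQ)) (arcN (nPQ _ _ xP bQ)) bP.
have tpQ : nontriv (p |: Q).
  apply: (@nontrivI _ p q p'); rewrite ?inE ?eqxx ?qQ ?orbT // ?negb_or ?np'p ?PQ //.
  have all x v : x \in p |: Q -> v \notin p |: Q -> T v x = ~~ T p p'.
    rewrite !inE negb_or => xI /andP[nvp vQ].
    have vP : v \in P by move: (full v); rewrite (negbTE vQ) orbF.
    case/orP: xI => [/eqP->|xQ]; first exact: pPa.
    by rewrite (arcN (nPQ _ _ vP xQ)) QPa.
  by apply/moduleP=> x y v xI yI vI; rewrite (all x) // (all y).
have : P :\ p = P.
  apply: (mc_min PMC) (subsetDl _ _); rewrite -comodC; apply: nontriv_comod.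
  suff -> : ~: (P :\ p) = p |: Q by [].
  apply/setP=> x; rewrite !inE negb_and negbK; congr (_ || _).
  apply/idP/idP=> [xP|/QP//].
  by move: (full x); rewrite (negbTE xP).
by move/setP/(_ p); rewrite !inE eqxx pP.
Qed.

Lemma no_obstruction_comodule :
  nontriv (~: P) -> ~~ nontriv P -> 1 < #|P| ->
  ~~ (twins_but Q p q || isolated_but P p q).
Proof.
move=> tP ntP gt1; rewrite negb_or; apply/andP; split.
  apply/negP=> /twins_butP[b [bQ nbq h]].
  apply: (mc_separated PMC tP gt1 pP (QP bQ)) => v vP nvp.
  have nvb : v != b by rewrite (neq_mem vP) ?QP.
  have nvq : v != q by rewrite (neq_mem vP) ?QP.
  by move: (h v nvp nvb); rewrite (negbTE nvq) => /negbFE/eqP.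
apply: contra ntP => /isolated_butP[_ mP _].
by rewrite nontrivE mP gt1 (card_lt (QP qQ)).
Qed.

Lemma no_obstruction_isolated :
  nontriv P -> Q = [set q] -> ~~ (twins_but Q p q || isolated_but P p q).
Proof.
move=> tP eQ; rewrite negb_or; apply/andP; split.
  by apply/negP=> /twins_butP[b []]; rewrite eQ inE => ->.
apply/negP=> /isolated_butP[_ _ h].
have [eps hq] : exists eps, forall v, v != q -> T q v = eps.
  by apply: isolated_arc; rewrite -eQ; apply: mc_comod.
suff m : module [set p; q].
  by move: (good_nontriv gX (pair_nontriv npq m)); rewrite subxx.
apply/pairP=> v nvp nvq.
have [npv nqv] : p != v /\ q != v by rewrite ![_ == v]eq_sym.
by rewrite (arcN nvp) (arcN nvq) h // !hq.
Qed.

(** A pair that is no module is what [good_nontriv] asks of {p, q'}; the last two conditions exclude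
    the obstructions for both orders of its points. *)
Definition replacement q' :=
  [&& q' \in Q, ~~ module [set p; q'],
      ~~ (twins_but Q p q' || isolated_but P p q')
    & ~~ (twins_but P q' p || isolated_but Q q' p)].

(** With p a source or a sink, b behaves like p except against q. This makes Q a module, and then
    all of V but p. Of two vertices of Q other than q and b, at most one fails as a replacement. *)
Lemma replace_isolated : P = [set p] -> twins_but Q p q ->
  big Q /\ exists q', replacement q'.
Proof.
move=> eP tw.
have [eps hp] : exists eps, forall v, v != p -> T p v = eps.
  by apply: isolated_arc; rewrite -eP; apply: mc_comod.
have pQ := PQ pP.
have [b [bQ nbq hb]] := twins_but_isolated hp pQ qQ tw.
have [nbp nqp] := (neq_mem bQ pQ, neq_mem qQ pQ).
have bp : T b p = ~~ eps by rewrite arcN // hp // eq_sym.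
have tQ : nontriv Q.
  case/orP: (mc_comod QMC) => // tC.
  have [w wQ nwp] := nontriv_other p tC; rewrite inE in wQ.
  have [nbw nqw] := (neq_mem bQ wQ, neq_mem qQ wQ).
  have : T b p = T b w.
    by apply: (moduleP _ _ (nontriv_module tC)); rewrite ?inE ?negbK.
  rewrite bp hb ?[w == _]eq_sym //; first by rewrite (negbTE nqw); case: eps {hp hb bp}.
  by rewrite eq_sym.
have mQ := nontriv_module tQ.
have full r : r != p -> r \in Q.
  move=> nrp; apply/negPn/negP=> rQ.
  have [nbr nqr] := (neq_mem bQ rQ, neq_mem qQ rQ).
  have all x s : x \in p |: Q -> s \notin p |: Q -> T s x = ~~ eps.
    rewrite !inE negb_or => xI /andP[nsp sQ].
    case/orP: xI => [/eqP->|xQ]; first by rewrite arcN // hp.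
    have nsx : s != x by rewrite eq_sym (neq_mem xQ).
    have nsb : s != b by rewrite eq_sym (neq_mem bQ).
    have nsq : s != q by rewrite eq_sym (neq_mem qQ).
    by rewrite (arcN nsx) (module_arc mQ xQ bQ) // hb // (negbTE nsq).
  have /nontriv_comod : nontriv (p |: Q).
    apply: (@nontrivI _ p q r); rewrite ?inE ?eqxx ?qQ ?orbT ?negb_or ?nrp ?rQ //.
    by apply/moduleP=> x y v xI yI vI; rewrite !all.
  by rewrite -comodC => /hit; rewrite !inE eqxx qQ orbT.
have eQ : Q = [set~ p].
  apply/setP=> x; rewrite !inE; apply/idP/idP=> [xQ|/full//].
  exact: neq_mem xQ pQ.
have card_Q : 3 < #|Q|.
  by rewrite eQ cardsC1; case: #|V| order_ge5 => [|[|[|[|[|n]]]]].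
have bigQ : big Q.
  rewrite /big QMC; apply/andP; split; first by case: #|_| card_Q => [|[|n]].
  by rewrite negb_and; case: #|_| card_Q => [|[|[|n]]].
split=> //.
have := card_Q; rewrite (cardsD1 b) bQ (cardsD1 q) !inE eq_sym nbq qQ.
rewrite !addnA !add1n !ltnS => /card_gt1P[w1 [w2 []]].
rewrite !inE => /and3P[n1q n1b w1Q] /and3P[n2q n2b w2Q] n12.
(* The new twin of p can only be q, so w is the one vertex of Q where q departs from p; two
   different w cannot both be so. *)
have bad w : w \in Q -> w != q -> w != b -> twins_but Q p w ->
    forall v, v != p -> v != q -> T q v = (v == w) (+) eps.
  move=> wQ nwq nwb /(twins_but_isolated hp pQ wQ)[b1 [b1Q nb1w hb1]].
  have nb1p := neq_mem b1Q pQ.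
  suff -> : q = b1 by [].
  have nwp := neq_mem wQ pQ.
  have [eb1|nb1b] := eqVneq b1 b.
    have nwb1 : w != b1 by rewrite eb1.
    have := hb w nwp nwb; rewrite -eb1 (hb1 w nwp nwb1) eqxx (negbTE nwq).
    by case: eps {hp hb hb1 bp}.
  apply/eqP; rewrite eq_sym; apply/negPn/negP=> nb1q.
  have nbb1 : b != b1 by rewrite eq_sym.
  have nbw : b != w by rewrite eq_sym.
  have := arcN nbb1; rewrite hb // hb1 // (negbTE nb1q) (negbTE nbw).
  by case: eps {hp hb hb1 bp}.
have okw w : w \in Q -> w != q -> w != b -> ~~ twins_but Q p w -> replacement w.
  move=> wQ nwq nwb ntw; rewrite /replacement wQ (negbTE ntw) /=.
  have nwp := neq_mem wQ pQ; apply/and3P; split.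
  - apply/negP=> /pairP/(_ b nbp); rewrite eq_sym => /(_ nwb).
    by rewrite bp hb // (negbTE nwq); case: eps {hp hb bp bad}.
  - by apply/negP=> /isolated_butP[]; rewrite eP cards1.
  rewrite negb_or; apply/andP; split.
    by apply/negP=> /twins_butP[x []]; rewrite eP inE => ->.
  by apply/negP=> /isolated_butP[cQ]; rewrite cQ in card_Q.
have [t1|t1] := boolP (twins_but Q p w1); last by exists w1; apply: okw.
have [t2|t2] := boolP (twins_but Q p w2); last by exists w2; apply: okw.
have n1p := neq_mem w1Q pQ.
have := bad w1 w1Q n1q n1b t1 w1 n1p n1q.
rewrite (bad w2 w2Q n2q n2b t2 w1 n1p n1q) eqxx (negbTE n12).
by case: eps {hp hb bp bad}.
Qed.

(** Since Q is not a module, [okw] leaves only the two obstructions on the side of p. Either some q0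
    in Q isolates p, and two other vertices of Q are tried, or the twin obstruction cannot hold for
    every w in Q. *)
Lemma replace_comodule :
  nontriv P -> nontriv (~: Q) -> ~~ nontriv Q -> 1 < #|Q| ->
  big Q /\ exists q', replacement q'.
Proof.
move=> tP tQ ntQ gt1; have mP := nontriv_module tP; have pQ := PQ pP.
have nmQ : ~~ module Q.
  by apply: contra ntQ => mQ; rewrite nontrivE mQ gt1 (card_lt pQ).
have bigQ : big Q.
  by rewrite /big QMC (negbTE nmQ) andbF andbT; case: #|_| gt1 => [|[|n]].
split=> //.
have [p' p'P np'p] := nontriv_other p tP.
have npp' : p != p' by rewrite eq_sym.
have nQP x y : x \in Q -> y \in P -> x != y.
  by move=> xQ yP; rewrite (neq_mem xQ) ?PQ.
have nPQ x y : x \in P -> y \in Q -> x != y.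
  by move=> xP yQ; rewrite eq_sym nQP.
set eps := T p p'.
have okw w : w \in Q -> ~~ twins_but Q p w -> ~~ isolated_but P p w -> replacement w.
  move=> wQ ntw niw; rewrite /replacement wQ (negbTE ntw) (negbTE niw) /=.
  apply/andP; split.
    rewrite setUC; apply/negP=> /(big_twin bigQ wQ (nPQ _ _ pP wQ))[cp _].
    by move: tP; rewrite (mc_isolated PMC pP cp) nontrivE cards1 andbF.
  rewrite negb_or; apply/andP; split.
    apply/negP=> /twins_butP[b [bP nbp h]].
    apply: (mc_separated QMC tQ gt1 wQ (PQ bP)) => v vQ nvw.
    move: (h v nvw (nQP _ _ vQ bP)); rewrite (negbTE (nQP _ _ vQ pP)).
    by move/negbFE/eqP.
  by apply/negP=> /isolated_butP[_ mQ _]; rewrite mQ in nmQ.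
have arc_b w b : w \in Q -> b \in Q ->
    (forall v, v != p -> v != b -> (T v p != T v b) = (v == w)) -> T b p = eps.
  move=> wQ bQ h; rewrite (moduleP _ _ mP p p' b pP p'P (QP bQ)).
  have := h p' np'p (nPQ _ _ p'P bQ); rewrite (negbTE (nPQ _ _ p'P wQ)).
  by move=> /negbFE/eqP e; rewrite /eps (arcN (nQP _ _ bQ p'P)) -e -arcN.
have iso_eps w : w \in Q -> isolated_but P p w ->
    T w p = eps /\ forall v, v != p -> v != w -> T p v = eps.
  move=> wQ /isolated_butP[_ _ h].
  have e : T w p = eps by rewrite -(h p') // nPQ.
  by split=> // v nvp nvw; rewrite h.
have [/exists_inP[q0 q0Q iq0]|/exists_inPn none] :=
    boolP [exists w in Q, isolated_but P p w].
  have [q0p pv] := iso_eps q0 q0Q iq0.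
  have nq0p := nQP _ _ q0Q pP; have npq0 : p != q0 by rewrite eq_sym.
  (* A larger set would be a nontrivial module missing both p and q. So Q has at least three
     vertices, two of them other than q0. *)
  have small : #|~: Q :\ p| <= 1.
    rewrite leqNgt; apply/negP=> gt1C.
    have : nontriv (~: Q :\ p).
      rewrite nontrivE gt1C (card_lt (z := p)) ?inE ?eqxx // !andbT.
      apply/moduleP=> x y v; rewrite !inE negb_and !negbK.
      move=> /andP[nxp xQ] /andP[nyp yQ] /orP[/eqP->|vQ].
        by rewrite !pv // eq_sym; apply: neq_mem q0Q _.
      by apply: (moduleP _ _ (nontriv_module tQ)); rewrite ?inE ?negbK.
    by move/nontriv_comod/hit; rewrite !inE eqxx qQ andbF.
  have := cardsC Q; rewrite (cardsD1 p (~: Q)) inE pQ (cardsD1 q0 Q) q0Q => cQ.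
  have : 1 < #|Q :\ q0|.
    move: order_ge5; rewrite -cQ; case: #|_ :\ q0| => [|[|n]] //;
    by case: #|_ :\ p| small => [|[|m]].
  case/card_gt1P=> w1 [w2 []]; rewrite !inE => /andP[n1 w1Q] /andP[n2 w2Q] n12.
  have niso w : w \in Q -> w != q0 -> ~~ isolated_but P p w.
    move=> wQ nwq0; apply/negP=> /(iso_eps w wQ)[_ /(_ q0 nq0p)].
    rewrite eq_sym => /(_ nwq0); rewrite (arcN npq0) q0p.
    by case: (eps).
  (* The twin of p must be q0, the only vertex of Q that beats p when [eps] holds, or loses to it
     otherwise; so w is determined. *)
  have sep w : w \in Q -> w != q0 -> twins_but Q p w ->
      forall v, v != p -> v != q0 -> (T v p != T v q0) = (v == w).
    move=> wQ nwq0 /twins_butP[b [bQ nbw h]].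
    suff -> : q0 = b by [].
    apply/eqP/negPn/negP; rewrite eq_sym => nbq0.
    have nbp := nQP _ _ bQ pP.
    have := arcN nbp; rewrite (arc_b w b) // pv //.
    by case: (eps).
  have [t1|t1] := boolP (twins_but Q p w1); last first.
    by exists w1; apply: okw; rewrite ?niso.
  have [t2|t2] := boolP (twins_but Q p w2); last first.
    by exists w2; apply: okw; rewrite ?niso.
  have := sep w1 w1Q n1 t1 w1 (nQP _ _ w1Q pP) n1.
  by rewrite (sep w2 w2Q n2 t2 w1 (nQP _ _ w1Q pP) n1) eqxx (negbTE n12).
have [/exists_inP[w wQ ntw]|/exists_inPn all_tw] :=
    boolP [exists w in Q, ~~ twins_but Q p w].
  by exists w; apply: okw => //; apply: none.
case/negP: nmQ.
pose witness w b := (b \in Q) && ((b != w) &&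
  [forall v, (v != p) ==> (v != b) ==> ((T v p != T v b) == (v == w))]).
(* If every w were obstructed, sending w to the twin it creates would be an injection of Q into
   itself, hence onto. All vertices of Q would then have the same arc to p, making Q a module. The
   default p is not reached on Q. *)
pose f w := odflt p [pick b | witness w b].
have fP w : w \in Q -> [/\ f w \in Q, f w != w
    & forall v, v != p -> v != f w -> (T v p != T v (f w)) = (v == w)].
  move=> wQ; rewrite /f; case: pickP => [b /and3P[bQ nbw /forallP h]|nob].
    split=> // v nvp nvb; move: (h v); rewrite nvp nvb.
    by move/eqP.
  have := all_tw w wQ; rewrite negbK => /existsP[b].
  by have := nob b; rewrite /witness => ->.
have inj_f : {in Q &, injective f}.
  move=> w w' wQ w'Q e; have [_ nf h] := fP w wQ; have [_ _ h'] := fP w' w'Q.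
  rewrite eq_sym in nf; have nwp := nQP _ _ wQ pP.
  by apply/eqP; rewrite -(h' w) // -?e // h // eqxx.
have fQ : f @: Q = Q.
  apply/eqP; rewrite eqEcard (card_in_imset inj_f) leqnn andbT.
  by apply/subsetP=> _ /imsetP[w wQ ->]; case: (fP w wQ).
have Qp x y : x \in Q -> y \notin Q -> T y x = ~~ eps.
  move=> xQ yQ; have nyx : y != x by rewrite eq_sym (neq_mem xQ).
  rewrite (arcN nyx); congr (~~ _).
  have -> : T x y = T x p.
    by apply: (moduleP _ _ (nontriv_module tQ)); rewrite ?inE ?negbK.
  move: (xQ); rewrite -{1}fQ => /imsetP[w wQ ex]; have [_ _ h] := fP w wQ.
  by apply: (arc_b w); rewrite // ex.
by apply/moduleP=> x y v xQ yQ vQ; rewrite !Qp.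
Qed.

(** Sorting P and Q into singletons, modules and complements of modules, obstructions survive only
    if P is a singleton, or if P is a module and Q, not a singleton, is only the complement of
    one. *)
Lemma replace : twins_but Q p q || isolated_but P p q ->
  big Q /\ exists q', replacement q'.
Proof.
move=> obs; have obsN : ~~ ~~ (twins_but Q p q || isolated_but P p q) by rewrite negbK.
have single x : x \in G x -> #|G x| <= 1 -> G x = [set x].
  by move=> xG le1; apply/eqP; rewrite eq_sym eqEcard sub1set xG cards1.
have [le1|gt1] := leqP #|P| 1.
  have eP := single p pP le1; apply: replace_isolated => //.
  by case/orP: obs => // /isolated_butP[]; rewrite eP cards1.
have [tP|ntP] := boolP (nontriv P); last first.
  case/negP: obsN; apply: no_obstruction_comodule => //.
  by case/orP: (mc_comod PMC) => //; rewrite (negbTE ntP).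
have [tQ|ntQ] := boolP (nontriv Q).
  by case/negP: obsN; apply: no_obstruction_modules.
have [le1Q|gt1Q] := leqP #|Q| 1.
  case/negP: obsN; apply: no_obstruction_isolated => //; exact: single.
apply: replace_comodule => //.
by case/orP: (mc_comod QMC) => //; rewrite (negbTE ntQ).
Qed.

(** Since Q is big, the only minimal co-module containing q is Q, and q' hits it as well. *)
Lemma good_replace q' : big Q -> replacement q' ->
  good [set p; q'] (fun x => if x == p then P else Q).
Proof.
move=> bigQ /and4P[q'Q nm _ _].
have npq' : p != q' by rewrite (neq_mem pP) // QP.
have nq'p : q' == p = false by rewrite eq_sym (negbTE npq').
split.
- by move=> x _; case: ifP.
- by move=> x; rewrite !inE => /orP[]/eqP->; rewrite ?eqxx ?nq'p.
- move=> x y w; rewrite !inE => /orP[]/eqP-> /orP[]/eqP->; rewrite ?eqxx ?nq'p //.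
    by move=> /PQ/negbTE->.
  by move=> /QP/negbTE->.
- move=> D cD; have [M hM /subsetP sM] := comod_mc cD.
  suff : (p \in M) || (q' \in M).
    by case/orP=> /sM xD; [exists p | exists q']; rewrite ?set21 ?set22.
  case/orP: (hit (mc_comod hM)) => [->//|qM].
  by rewrite -(mc_meet_big bigQ hM qQ qM) q'Q orbT.
move=> N tN; apply: contra nm => sN.
have gt1 : 1 < #|N| by move: tN; rewrite nontrivE => /and3P[].
by have [<- _] := pair_eq gt1 sN; apply: nontriv_module.
Qed.

Lemma indecomposable_replace q' : big Q -> replacement q' ->
  indecomposable (Inv T [set p; q']).
Proof.
move=> bigQ rq; have gX' := good_replace bigQ rq.
case/and4P: rq => q'Q _ no1 no2.
have npq' : p != q' by rewrite (neq_mem pP) // QP.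
have nq'p : q' == p = false by rewrite eq_sym (negbTE npq').
apply/negPn/negP=> /(good_obstruction gX')[a [c [nac eX]]].
have : a \in [set p; q'] by rewrite eX set21.
have : c \in [set p; q'] by rewrite eX set22.
rewrite !inE => /orP[]/eqP ec /orP[]/eqP ea; move: nac; rewrite ea ec ?eqxx ?nq'p // => _.
  by rewrite (negbTE no2).
by rewrite (negbTE no1).
Qed.

End Replace.

(** * Existence of the reversed set and value of the index *)

Lemma good_indecomposable : exists X G, good X G /\ indecomposable (Inv T X).
Proof.
have [X [G gX]] := good_exists.
have [ind|/(good_obstruction gX)] := boolP (indecomposable (Inv T X)).
  by exists X, G.
case=> p [q [npq eX obs]]; rewrite {X}eX in gX *.
have [bigQ [q' rq]] := replace gX npq obs.
exists [set p; q'], (fun x => if x == p then G p else G q); split.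
  exact (good_replace gX npq bigQ rq).
exact (indecomposable_replace gX npq bigQ rq).
Qed.

End Tournament.

Theorem theorem1p4 (V : finType) (T : rel V) (tourT : tournament T)
    (order_ge5 : 5 <= #|V|)
    (not_even_transitive : ~ (transitive T /\ ~~ odd #|V|)) :
  (exists X : {set V},
     [/\ X \subset cover (mc T), #|X| = comodular_index T
       & indecomposable (Inv T X)]) /\
  is_subtournament_index T (comodular_index T).
Proof.
have [X [G [gX ind]]] := good_indecomposable tourT order_ge5 not_even_transitive.
have cX := good_card order_ge5 gX.
split; first by exists X; split; [apply: good_cover gX | |].
split=> [|Y indY]; first by exists X.
apply: (comodular_index_le order_ge5) => D cD.
have [dYD|/pred0Pn[x /andP[xY xD]]] := boolP [disjoint Y & D]; last by exists x.
by case/negP: (comod_disjoint_decomposable cD dYD).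
Qed.
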